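(* For every fixed integer $k$, there is an algorithm which, given an acyclic implicational base $(X,\Sigma)$ with $\mathrm{pdeg}(\Sigma)\le k$, enumerates all irreducible closed sets of the closure system represented by $(X,\Sigma)$ in incremental-polynomial time; and likewise, for every fixed integer $k$, there is an incremental-polynomial time algorithm doing the same for acyclic implicational bases $(X,\Sigma)$ with $\mathrm{cdeg}(\Sigma)\le k$.
   Context: A closure system on a finite set $X$ is a family $\mathcal{C}\subseteq 2^X$ with $X\in\mathcal{C}$, closed under intersection; throughout, $\emptyset\in\mathcal{C}$ is assumed. An implicational base $(X,\Sigma)$ is a finite set $\Sigma$ of implications $A\to B$ with $A,B\subseteq X$ (premise $A$, conclusion $B$, always taken disjoint); $C\subseteq X$ is closed for $\Sigma$ if for each $A\to B\in\Sigma$, $A\subseteq C$ implies $B\subseteq C$; these closed sets form the closure system represented by $\Sigma$. For $x\in X$, $\mathrm{irr}(x)$ is the family of inclusion-maximal closed sets not containing $x$, and the irreducible closed sets are $\mathrm{irr}(\mathcal{C})=\bigcup_{x\in X}\mathrm{irr}(x)$. The implication graph $G(\Sigma)$ is the digraph on $X$ with an arc $ab$ whenever $a\in A$, $b\in B$ for some $A\to B\in\Sigma$; $\Sigma$ is acyclic if $G(\Sigma)$ is. The premise-degree of $x$ is the number of implications of $\Sigma$ whose premise contains $x$, its conclusion-degree is the number of implications whose conclusion contains $x$; $\mathrm{pdeg}(\Sigma)$ and $\mathrm{cdeg}(\Sigma)$ are the maxima over $x\in X$. The input size is $|X|+|\Sigma|$. An enumeration algorithm runs in incremental-polynomial time if,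 for every $i$, it outputs the $i$-th solution (and, after the last, halts) within time polynomial in the input size plus $i$, without repetitions. *)

(* Defs.v *)
From mathcomp Require Import all_boot all_order all_algebra.

Set Implicit Arguments.
Unset Strict Implicit.
Unset Printing Implicit Defensive.

Section ImplicationalBases.
Variable X : finType.

Implicit Types (Sigma : {set {set X} * {set X}}) (F : {set {set X}}).

Definition closed_sets Sigma : {set {set X}} :=
  [set C : {set X} | [forall r in Sigma, (r.1 \subset C) ==> (r.2 \subset C)]].

(* The clause on [set0] is the standing assumption that the empty set is
   closed. *)
Definition implicational_base Sigma : Prop :=
  (forall r, r \in Sigma -> [disjoint r.1 & r.2]) /\
  set0 \in closed_sets Sigma.

Definition closure_system F : Prop :=
  setT \in F /\ (forall C D, C \in F -> D \in F -> C :&: D \in F).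

Lemma closed_sets_closure_system Sigma : closure_system (closed_sets Sigma).
Proof.
split=> [|C D]; rewrite !inE.
  by apply/forall_inP => r _; apply/implyP => _; apply: subsetT.
move=> /forall_inP hC /forall_inP hD; apply/forall_inP => r hr.
rewrite !subsetI; apply/implyP => /andP[rC rD].
by rewrite (implyP (hC r hr) rC) (implyP (hD r hr) rD).
Qed.

Definition irr_at F (x : X) : {set {set X}} :=
  [set C : {set X} | maxset [pred D : {set X} | (D \in F) && (x \notin D)] C].

Definition irr F : {set {set X}} := \bigcup_(x : X) irr_at F x.

Definition implication_graph Sigma : rel X :=
  fun a b => [exists r in Sigma, (a \in r.1) && (b \in r.2)].

Definition acyclic Sigma : Prop :=
  forall c : seq X, cycle (implication_graph Sigma) c -> c = [::].

Definition premise_degree Sigma (x : X) : nat :=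
  #|[set r in Sigma | x \in r.1]|.
Definition conclusion_degree Sigma (x : X) : nat :=
  #|[set r in Sigma | x \in r.2]|.

Definition pdeg Sigma : nat := \max_(x : X) premise_degree Sigma x.
Definition cdeg Sigma : nat := \max_(x : X) conclusion_degree Sigma x.

End ImplicationalBases.

(* Model of computation: Jones's WHILE language over binary trees, extended
   with an output command.  Its only primitives on data are [Node] (cons), left
   and right projections, and the test whether a tree is a leaf.  Trees can be
   kept as shared pointer structures, each primitive taking constant time, so
   that running time agrees up to a polynomial with that of Turing machines or
   RAMs.  Outputting a tree is charged its full size, since it has to be
   written out. *)

Inductive tree : Type := Leaf | Node of tree & tree.

Fixpoint tree_size (t : tree) : nat :=
  if t is Node l r then (tree_size l + tree_size r).+1 else 1.

Inductive expr : Type :=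
  | Var of nat
  | Nil
  | Cons of expr & expr
  | Hd of expr
  | Tl of expr.

Inductive cmd : Type :=
  | Skip
  | Assign of nat & expr
  | Seq of cmd & cmd
  | If of expr & cmd & cmd
  | While of expr & cmd
  | Output of expr.

Definition store : Type := nat -> tree.

Definition update (s : store) (x : nat) (v : tree) : store :=
  fun y => if y == x then v else s y.

Definition is_node (t : tree) : bool := if t is Node _ _ then true else false.

Fixpoint eval (s : store) (e : expr) : tree :=
  match e with
  | Var x => s x
  | Nil => Leaf
  | Cons e1 e2 => Node (eval s e1) (eval s e2)
  | Hd e1 => if eval s e1 is Node l _ then l else Leaf
  | Tl e1 => if eval s e1 is Node _ r then r else Leaf
  end.

Fixpoint expr_cost (e : expr) : nat :=
  match e with
  | Var _ | Nil => 1
  | Cons e1 e2 => (expr_cost e1 + expr_cost e2).+1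
  | Hd e1 | Tl e1 => (expr_cost e1).+1
  end.

(* The outputs of a run in chronological order, each with the time at which it
   is completed. *)
Definition trace : Type := seq (nat * tree).

Definition delay (t : nat) (tr : trace) : trace :=
  [seq (t + o.1, o.2) | o <- tr].

(* [exec c s s' t tr]: from store [s], command [c] halts in store [s'] after
   [t] time units, having produced the trace [tr]. *)
Inductive exec : cmd -> store -> store -> nat -> trace -> Prop :=
  | exec_Skip s : exec Skip s s 1 [::]
  | exec_Assign x e s :
      exec (Assign x e) s (update s x (eval s e)) (expr_cost e).+1 [::]
  | exec_Seq c1 c2 s1 s2 s3 t1 t2 tr1 tr2 :
      exec c1 s1 s2 t1 tr1 -> exec c2 s2 s3 t2 tr2 ->
      exec (Seq c1 c2) s1 s3 (t1 + t2) (tr1 ++ delay t1 tr2)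
  | exec_If e c1 c2 s s' t tr :
      exec (if is_node (eval s e) then c1 else c2) s s' t tr ->
      exec (If e c1 c2) s s' ((expr_cost e).+1 + t)
           (delay (expr_cost e).+1 tr)
  | exec_While_stop e c s :
      ~~ is_node (eval s e) ->
      exec (While e c) s s (expr_cost e).+1 [::]
  | exec_While_step e c s1 s2 s3 t1 t2 tr1 tr2 :
      is_node (eval s1 e) ->
      exec c s1 s2 t1 tr1 -> exec (While e c) s2 s3 t2 tr2 ->
      exec (While e c) s1 s3 ((expr_cost e).+1 + (t1 + t2))
           (delay (expr_cost e).+1 (tr1 ++ delay t1 tr2))
  | exec_Output e s :
      exec (Output e) s s (expr_cost e + tree_size (eval s e)).+1
           [:: ((expr_cost e + tree_size (eval s e)).+1, eval s e)].

Lemma exec_deterministic c s s1 s2 t1 t2 tr1 tr2 :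
  exec c s s1 t1 tr1 -> exec c s s2 t2 tr2 ->
  [/\ s1 = s2, t1 = t2 & tr1 = tr2].
Proof.
move=> h; elim: h s2 t2 tr2 => {c s s1 t1 tr1}.
- by move=> s s2 t2 tr2 h; inversion h.
- by move=> x e s s2 t2 tr2 h; inversion h.
- move=> c1 c2 s1 s2 s3 t1 t2 tr1 tr2 _ IH1 _ IH2 s4 t4 tr4 h.
  inversion h as [| |? ? ? ? ? ? ? ? ? h1 h2| | | |]; subst.
  case: (IH1 _ _ _ h1) => ? ? ?; subst.
  by case: (IH2 _ _ _ h2) => -> -> ->.
- move=> e c1 c2 s s' t tr _ IH s2 t2 tr2 h.
  inversion h as [| | |? ? ? ? ? ? ? h1| | |]; subst.
  by case: (IH _ _ _ h1) => -> -> ->.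
- move=> e c s he s2 t2 tr2 h.
  inversion h as [| | | | |? ? ? ? ? ? ? ? ? he'|]; subst => //.
  by rewrite he' in he.
- move=> e c s1 s2 s3 t1 t2 tr1 tr2 he _ IH1 _ IH2 s4 t4 tr4 h.
  inversion h as [| | | |? ? ? he'|? ? ? ? ? ? ? ? ? he' h1 h2|]; subst.
    by rewrite he in he'.
  case: (IH1 _ _ _ h1) => ? ? ?; subst.
  by case: (IH2 _ _ _ h2) => -> -> ->.
- by move=> e s s2 t2 tr2 h; inversion h.
Qed.

Definition initial_store (input : tree) : store :=
  update (fun=> Leaf) 0 input.

Definition encode_bool (b : bool) : tree := if b then Node Leaf Leaf else Leaf.

Definition encode_list (ts : seq tree) : tree := foldr Node Leaf ts.

(* Subsets of [X] are encoded as their characteristic vectors along a listing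
   [xs] of [X]. *)
Definition encode_set (X : finType) (xs : seq X) (A : {set X}) : tree :=
  encode_list [seq encode_bool (x \in A) | x <- xs].

Definition encode_implication (X : finType) (xs : seq X)
    (r : {set X} * {set X}) : tree :=
  Node (encode_set xs r.1) (encode_set xs r.2).

Definition encode_base (X : finType) (xs : seq X)
    (rs : seq ({set X} * {set X})) : tree :=
  Node (encode_set xs [set: X])
       (encode_list [seq encode_implication xs r | r <- rs]).

(* A halting run of duration [t] with trace [tr] on an input of size [n] meets
   the incremental bound [p]: the [i]-th output, counted from 1, is completed
   by time [p(n + i)], and the run halts by time [p(n + m)] where [m] is the
   number of outputs. *)
Definition incremental_bound (p : {poly nat}) (n t : nat) (tr : trace) : Prop :=
  (forall i, (i < size tr)%N ->
     ((nth (0, Leaf) tr i).1 <= p.[(n + i.+1)%N]%R)%N) /\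
  (t <= p.[(n + size tr)%N]%R)%N.

(* [c] enumerates, in incremental-polynomial time, the irreducible closed sets
   of every implicational base satisfying [P], in whatever order the elements
   and the implications are listed in the input. *)
Definition enumerates_irr_incremental_poly
    (P : forall X : finType, {set {set X} * {set X}} -> Prop) (c : cmd) : Prop :=
  exists p : {poly nat},
  forall (X : finType) (Sigma : {set {set X} * {set X}}),
    implicational_base Sigma -> P X Sigma ->
  forall (xs : seq X) (rs : seq ({set X} * {set X})),
    perm_eq xs (enum X) -> perm_eq rs (enum Sigma) ->
  exists (s : store) (t : nat) (tr : trace) (sols : seq {set X}),
    [/\ exec c (initial_store (encode_base xs rs)) s t tr,
        perm_eq sols (enum (irr (closed_sets Sigma))),
        [seq o.2 | o <- tr] = [seq encode_set xs C | C <- sols]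
      & incremental_bound p (#|X| + #|Sigma|) t tr].

(* Main.v *)
From mathcomp Require Import all_boot all_order all_algebra zify.
Require Import Defs.

Set Implicit Arguments.
Unset Strict Implicit.
Unset Printing Implicit Defensive.

(** One saturation procedure serves both degree bounds.  Let [L] be the list of
    irreducible closed sets found so far.  For every intersection [I] of [k + 1]
    sets among [X], the empty set and the members of [L], and all elements [x],
    [y], form [(I + y) - x]; if it is closed, complete it greedily to a maximal
    closed set avoiding [x], and output the result if it is new.  A round takes
    polynomial time in the input and [L], so it suffices that a list without new
    candidates is complete.

    If [cdeg <= k], then [M] in [irr x] equals [I - x], where [I] intersects, for
    each implication [A -> B] with [x] in [B], a set of [irr a] containing [M],
    for some [a] in [A] outside [M]; such [a] precede [x] in the acyclic
    implication graph.  If [pdeg <= k], a missing [M'] in [irr x] is approached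
    from some [M] in [irr x] already found: add the last element [y] of [M' - M]
    and, for each implication with [y] in its premise [A] not contained in [M'],
    intersect with a set of [irr a] properly containing [M'], for some [a] in [A]
    outside [M'].  The result is closed, avoids [x] and contains [M & M'] and
    [y], so its completion meets [M'] in a larger set. *)

(** * Acyclic implicational bases *)

Section AcyclicBases.
Variables (X : finType) (Sigma : {set {set X} * {set X}}).
Local Notation arc := (implication_graph Sigma).
Local Notation closed := (closed_sets Sigma).

Definition reach (x : X) : {set X} := [set z | connect arc x z].

Lemma closedP (C : {set X}) :
  reflect (forall r, r \in Sigma -> r.1 \subset C -> r.2 \subset C)
          (C \in closed).
Proof.
rewrite inE; apply: (iffP forall_inP) => h r hr; last first.
  by apply/implyP; apply: h.
by apply/implyP; apply: h.
Qed.

Lemma arcP (r : {set X} * {set X}) a b :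
  r \in Sigma -> a \in r.1 -> b \in r.2 -> arc a b.
Proof. by move=> hr ha hb; apply/existsP; exists r; rewrite hr ha hb. Qed.

Lemma closedI (C D : {set X}) : C \in closed -> D \in closed -> C :&: D \in closed.
Proof. by case: (closed_sets_closure_system Sigma) => _; apply. Qed.

Lemma closed_setT : [set: X] \in closed.
Proof. by case: (closed_sets_closure_system Sigma). Qed.

Lemma closed_bigcap (T : finType) (P : pred T) (F : T -> {set X}) :
  (forall i, P i -> F i \in closed) -> \bigcap_(i | P i) F i \in closed.
Proof.
by move=> h; apply: (big_ind (fun C => C \in closed));
  [exact: closed_setT | exact: closedI | exact: h].
Qed.

Lemma irr_atP (x : X) (C : {set X}) :
  reflect [/\ C \in closed, x \notin C &
             forall D, D \in closed -> x \notin D -> C \subset D -> D = C]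
          (C \in irr_at closed x).
Proof.
apply: (iffP idP) => [|[h1 h2 h3]].
  rewrite in_set => /maxsetP[/andP[h1 h2] h3].
  by split=> // D hD xD; apply: h3; rewrite /= hD xD.
rewrite in_set; apply/maxsetP.
by split=> [|D /andP[hD xD]]; [rewrite /= h1 h2 | apply: h3].
Qed.

Lemma irrP (C : {set X}) :
  reflect (exists x, C \in irr_at closed x) (C \in irr closed).
Proof.
by apply: (iffP bigcupP) => [[x _ h]|[x h]]; exists x.
Qed.

Lemma irr_at_extend (x : X) (D : {set X}) :
  D \in closed -> x \notin D -> exists2 C, C \in irr_at closed x & D \subset C.
Proof.
move=> hD xD.
have := @maxset_exists _ [pred E : {set X} | (E \in closed) && (x \notin E)] D.
by rewrite /= hD xD => /(_ isT)[C hC DC]; exists C; rewrite // inE.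
Qed.

Hypothesis acyclicS : acyclic Sigma.

Lemma arc_no_return a b : arc a b -> a \notin reach b.
Proof.
move=> ab; rewrite inE; apply/negP => /connectP[p bp alast].
have /acyclicS // : cycle arc (b :: p).
by rewrite /= rcons_path bp -alast.
Qed.

(** The number of reachable elements thus drops along every arc; it serves as a rank in place of a
    topological order. *)
Lemma reach_arc a b : arc a b -> reach b \proper reach a.
Proof.
move=> ab; apply/properP; split.
  by apply/subsetP=> z; rewrite !inE; apply/connect_trans/connect1.
by exists a; [rewrite inE connect0 | exact: arc_no_return].
Qed.

(** Any element of [S] with the fewest reachable elements works, as an arc from it would lead to one
    reaching fewer. *)
Lemma exists_last (S : {set X}) (y0 : X) :
  y0 \in S -> exists2 y, y \in S & forall z, z \in S -> ~~ arc y z.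
Proof.
move=> hy0; case: (arg_minnP (fun y => #|reach y|) hy0) => y hy ymin.
exists y => // z hz; apply/negP => /reach_arc/proper_card.
by rewrite ltnNge ymin.
Qed.

(** Growth by single elements never gets stuck below a larger closed set: take for [z] a last
    element of [E :\: D]. An implication through [z] with premise in [z |: D] concludes inside [E],
    and a conclusion outside [D] would give an arc from [z] inside [E :\: D]. *)
Lemma closed_grow (D E : {set X}) :
  D \in closed -> E \in closed -> D \proper E ->
  exists z, [/\ z \in E, z \notin D & z |: D \in closed].
Proof.
move=> /closedP hD /closedP hE /properP[DE [z0 z0E z0D]].
have [|y] := @exists_last (E :\: D) z0; first by rewrite inE z0E z0D.
rewrite inE => /andP[yD yE] ylast; exists y; split=> //.
apply/closedP => r hr rsub.
have [yr|yr] := boolP (y \in r.1); last first.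
  apply: subset_trans (subsetUr _ _); apply: hD => //.
  apply/subsetP=> a ar; have /setU1P[ay|//] := subsetP rsub a ar.
  by rewrite -ay ar in yr.
have rE : r.2 \subset E.
  apply: hE => //; apply: subset_trans rsub _.
  by rewrite subUset sub1set yE DE.
apply/subsetP=> b br; rewrite !inE; case bD: (b \in D); first by rewrite orbT.
have /ylast : b \in E :\: D by rewrite inE bD (subsetP rE).
by rewrite (arcP hr yr br).
Qed.

(* The unique upper cover: whatever else [x] forces would lead back to [x]. *)
Lemma irr_at_cover (x : X) (M : {set X}) :
  M \in irr_at closed x -> x |: M \in closed.
Proof.
move=> /irr_atP[/closedP hM xM maxM]; apply/closedP => r hr rsub.
apply/subsetP=> b br; rewrite !inE.
case bM: (b \in M); first by rewrite orbT.
have [xr|xr] := boolP (x \in r.1); last first.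
  have /(hM _ hr)/subsetP/(_ b br) : r.1 \subset M.
    apply/subsetP=> a ar; have /setU1P[ax|//] := subsetP rsub a ar.
    by rewrite -ax ar in xr.
  by rewrite bM.
have xb := arc_no_return (arcP hr xr br).
(* A premise meeting [reach b] has its conclusion there, so [M :|: reach b] is a closed set avoiding
   [x]; maximality then puts [b] in [M]. *)
suff h : M :|: reach b = M.
  by move: bM; rewrite -h !inE connect0 orbT.
apply: maxM; last exact: subsetUl.
  apply/closedP => r' hr' sub'.
  have [aM|] := boolP (r'.1 \subset M).
    by apply: subset_trans (subsetUl _ _); apply: hM.
  case/subsetPn => a ar' aM; apply: subset_trans (subsetUr _ _).
  have := subsetP sub' a ar'; rewrite !inE (negPf aM) /= => ba.
  apply/subsetP=> c cr'; rewrite inE.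
  by apply: connect_trans ba (connect1 (arcP hr' ar' cr')).
by rewrite inE (negPf xM).
Qed.

(** * Greedy completion to an irreducible set *)

Definition grow x (D : {set X}) (z : X) : {set X} :=
  if (x \notin z |: D) && (z |: D \in closed) then z |: D else D.

Definition grow_pass (xs : seq X) x D := foldl (grow x) D xs.

(** An element rejected early may become addable later, so passes are repeated; the outer [xs] only
    counts them. *)
Definition completion (xs : seq X) x D :=
  foldl (fun D (_ : X) => grow_pass xs x D) D xs.

Lemma sub_grow x (D : {set X}) z : D \subset grow x D z.
Proof. by rewrite /grow; case: ifP => // _; apply: subsetUr. Qed.

Lemma sub_grow_pass xs x (D : {set X}) : D \subset grow_pass xs x D.
Proof.
elim: xs D => [|z xs IH] D //=.
exact: subset_trans (sub_grow x D z) (IH _).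
Qed.

Lemma grow_pass_closed xs x (D : {set X}) : D \in closed -> x \notin D ->
  grow_pass xs x D \in closed /\ x \notin grow_pass xs x D.
Proof.
elim: xs D => [|z xs IH] D //= hD xD; apply: IH; rewrite /grow; case: ifP => //.
  by case/andP.
by case/andP.
Qed.

(** Growth only adds elements, so a pass that ends where it began changed nothing at any step. *)
Lemma grow_pass_fix xs x D :
  grow_pass xs x D = D -> {in xs, forall z, grow x D z = D}.
Proof.
elim: xs D => [|z xs IH] D //= h.
have hz : grow x D z = D.
  apply/eqP; rewrite eqEsubset sub_grow andbT -{2}h.
  exact: sub_grow_pass.
move=> w; rewrite inE => /predU1P[->|] //.
by apply: IH; rewrite -{2}h /grow_pass /= hz.
Qed.

Lemma completionE xs x D :
  completion xs x D = iter (size xs) (grow_pass xs x) D.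
Proof.
rewrite /completion; elim: {2 3}xs D => [|z ys IH] D //=.
by rewrite IH -iterSr.
Qed.

Lemma sub_completion xs x (D : {set X}) : D \subset completion xs x D.
Proof.
rewrite completionE; elim: (size xs) => //= j IH.
exact: subset_trans IH (sub_grow_pass _ _ _).
Qed.

(** Each pass before the fixpoint adds an element, so [size xs] passes suffice; by [closed_grow] a
    fixpoint is maximal among the closed sets avoiding [x]. *)
Lemma completion_irr_at xs x (D : {set X}) : xs =i X -> #|X| <= size xs ->
  D \in closed -> x \notin D -> completion xs x D \in irr_at closed x.
Proof.
move=> xsX szxs hD xD; rewrite completionE; set n := size xs.
pose E j := iter j (grow_pass xs x) D.
have hE j : E j \in closed /\ x \notin E j.
  by elim: j => //= j [h1 h2]; apply: grow_pass_closed.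
have step j : grow_pass xs x (E j) = E j \/ j <= #|E j|.
  elim: j => [|j [IH|IH]]; first by right.
    by left; rewrite /= -/(E j) !IH.
  have [h|h] := eqVneq (grow_pass xs x (E j)) (E j).
    by left; rewrite /= -/(E j) !h.
  right; apply: leq_ltn_trans IH _; apply: proper_card.
  by rewrite properEneq eq_sym h sub_grow_pass.
have [hn xn] := hE n.
have fixn : grow_pass xs x (E n) = E n.
  case: (step n) => // nE.
  (* In the remaining case the set has at least [#|X|] elements, so it would contain [x]. *)
  have : E n == setT by rewrite eqEcard subsetT cardsT (leq_trans szxs nE).
  by move=> /eqP ET; rewrite ET inE in xn.
apply/irr_atP; split=> // C hC xC EC.
apply/eqP; rewrite eqEsubset EC andbT; apply/idPn => nCE.
have [|z [zC zE zEc]] := closed_grow hn hC; first by rewrite properE EC.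
have := grow_pass_fix fixn (_ : z \in xs); rewrite xsX => /(_ isT).
rewrite /grow zEc andbT ifT => [h|].
  by move: zE; rewrite -h setU11.
rewrite !inE negb_or xn andbT; apply: contraNneq xC => ->.
exact: zC.
Qed.

Lemma completion_id xs x (M : {set X}) : M \in irr_at closed x -> xs =i X ->
  #|X| <= size xs -> completion xs x M = M.
Proof.
move=> /irr_atP[hM xM maxM] h1 h2.
have /irr_atP[h3 h4 _] := completion_irr_at h1 h2 hM xM.
by apply: maxM => //; apply: sub_completion.
Qed.

(** All words of length [j] over [base] are intersected, repetitions included. The accumulating
    folds mirror the loops of [POOL_STEP], so that both produce the same list in the same order. *)
Definition intersection_pool (base : seq {set X}) :=
  fix pool j := if j is j'.+1
    then foldl (fun acc I => foldl (fun acc' B => (I :&: B) :: acc') acc base)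
               [::] (pool j')
    else [:: [set: X]].

Lemma mem_pool_inner (base : seq {set X}) acc I C :
  (C \in foldl (fun acc' B => (I :&: B) :: acc') acc base) =
  (C \in acc) || (C \in [seq I :&: B | B <- base]).
Proof.
elim: base acc => [|B base IH] acc /=; first by rewrite orbF.
by rewrite IH !inE orbCA orbA.
Qed.

Lemma intersection_poolS base j I B : I \in intersection_pool base j ->
  B \in base -> I :&: B \in intersection_pool base j.+1.
Proof.
move=> /= hI hB; move: [::] => acc; rewrite -/(intersection_pool base j).
elim: (intersection_pool base j) acc hI => //= J P IH acc.
rewrite inE => /predU1P[<-|]; last exact: IH.
have: I :&: B \in foldl (fun acc' B0 => (I :&: B0) :: acc') acc base.
  by rewrite mem_pool_inner map_f ?orbT.
elim: P {IH} (foldl _ acc base) => //= K P IH acc' h; apply: IH.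
by rewrite mem_pool_inner h.
Qed.

(** Families of fewer than [j] sets are padded with [setT]. *)
Lemma mem_intersection_pool base j (s : seq {set X}) :
  setT \in base -> {subset s <= base} -> size s <= j ->
  \bigcap_(B <- s) B \in intersection_pool base j.
Proof.
move=> hT; elim: j s => [|j IH] [|B s] //= hs szs.
- by rewrite big_nil inE.
- rewrite big_nil -(setTI setT); apply: (@intersection_poolS _ j) => //.
  by have := IH [::]; rewrite big_nil; apply.
- rewrite big_cons setIC; apply: (@intersection_poolS _ j).
    by apply: IH => // C hC; apply: hs; rewrite inE hC orbT.
  by apply: hs; rewrite mem_head.
Qed.

Lemma size_intersection_pool base j :
  size (intersection_pool base j) = size base ^ j.
Proof.
elim: j => //= j IH; rewrite expnSr -IH.
have inner acc I :
    size (foldl (fun acc' B => (I :&: B) :: acc') acc base) =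
    size acc + size base.
  by elim: (base) acc => [|B b IHb] acc /=; rewrite ?addn0 // IHb addSnnS.
transitivity (size (@nil {set X}) + size (intersection_pool base j) * size base);
  last by [].
elim: (intersection_pool base j) [::] => [|I P IHP] acc /=; first by rewrite addn0.
by rewrite IHP inner mulSn addnA.
Qed.

(** With [y = x] this only deletes [x] from [I], as the conclusion-degree argument needs; with [x]
    outside [y |: I] it only adds [y], as in the improvement step for the premise-degree. *)
Definition candidate (I : {set X}) (y x : X) := (y |: I) :\ x.

(** * Completeness of a saturated list *)

Section Saturation.
Variables (xs : seq X) (k : nat) (L : seq {set X}).
Hypothesis xsX : xs =i X.
Hypothesis szxs : #|X| <= size xs.
Hypothesis closed0 : set0 \in closed.
Local Notation base := [:: setT, set0 & L].
Hypothesis saturated : forall I y x, I \in intersection_pool base k.+1 ->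
  candidate I y x \in closed -> completion xs x (candidate I y x) \in L.

(* Every [M] irreducible at [x] is, up to [x], the intersection of sets
   irreducible at in-neighbours of [x], one for each implication concluding
   [x]. *)
Lemma saturated_cdeg : cdeg Sigma <= k -> {subset irr closed <= L}.
Proof.
move=> hk M0 hM0; apply/idPn => nM0.
have [x0 hx0] := irrP _ hM0.
pose bad x := [exists M, (M \in irr_at closed x) && (M \notin L)].
have bad0 : bad x0 by apply/existsP; exists M0; rewrite hx0.
(* Among the elements with a missing irreducible set, one reaching the most is taken; its
   in-neighbours reach more, so their irreducible sets are all in [L]. *)
case: (arg_maxnP (fun x => #|reach x|) bad0) => x /existsP[M /andP[hM nM]] xmax.
have [cM xM maxM] := irr_atP _ _ hM.
pose S := [set r in Sigma | x \in r.2].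
(* Some premise element [a] lies outside [M], and an extension of [M] irreducible at [a] breaks the
   premise. Outside [S], [setT] is a default that makes the choice function total. *)
have pickr r : exists N : {set X}, r \in S ->
    [/\ N \in base, N \in closed, M \subset N & ~~ (r.1 \subset N)].
  have [rS|] := boolP (r \in S); last by exists setT.
  move: rS; rewrite inE => /andP[rS xr].
  have : ~~ (r.1 \subset M).
    apply/negP => /(closedP _ cM _ rS)/subsetP/(_ x xr).
    by rewrite (negPf xM).
  case/subsetPn => a ar aM.
  have [N hN MN] := irr_at_extend cM aM.
  have [cN aN _] := irr_atP _ _ hN.
  exists N => _; split=> //; last by apply/subsetPn; exists a.
  suff : N \in L by rewrite !inE => ->; rewrite !orbT.
  apply/idPn => nN; have /xmax h : bad a by apply/existsP; exists N; rewrite hN.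
  suff : #|reach x| < #|reach a| by rewrite ltnNge => /negP[]; apply: h.
  apply: proper_card; apply: reach_arc.
  exact: arcP ar xr.
have [F hF] := fin_all_exists pickr.
pose I := \bigcap_(B <- [seq F r | r in S]) B.
have IE : I = \bigcap_(r in S) F r by rewrite /I big_image.
have hI : I \in intersection_pool base k.+1.
  apply: mem_intersection_pool; first by rewrite mem_head.
    by move=> B /imageP[r rS ->]; case: (hF r rS).
  (* At most [k] sets are intersected here; the premise-degree case is the one that needs the extra
     factor of [k.+1]. *)
  rewrite size_image; apply: leq_trans (leqnSn k); apply: leq_trans hk.
  exact: (leq_bigmax (F := conclusion_degree Sigma)).
have cI : I \in closed.
  by rewrite IE; apply: closed_bigcap => r rS; case: (hF r rS).
(* Deleting [x] endangers only the implications concluding [x], and each of these has its premise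
   broken by its [F r]. *)
have cD : candidate I x x \in closed.
  apply/closedP => r hr; rewrite /candidate => rsub.
  have rI : r.1 \subset I.
    apply/subsetP=> a ar; have := subsetP rsub a ar.
    by rewrite !inE => /andP[/negPf ->].
  have [xr|xr] := boolP (x \in r.2).
    have rS : r \in S by rewrite inE hr.
    have [_ _ _ /negP[]] := hF r rS.
    by apply: subset_trans rI _; rewrite IE; apply: bigcap_inf.
  rewrite subsetD1 xr andbT; apply: subset_trans (subsetUr _ _).
  exact: (closedP _ cI).
have DM : candidate I x x = M.
  apply: maxM => //; first by rewrite !inE eqxx.
  rewrite subsetD1 xM andbT; apply: subset_trans (subsetUr _ _).
  by rewrite IE; apply/bigcapsP => r rS; case: (hF r rS).
have := saturated hI cD; rewrite DM (completion_id hM) //.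
by rewrite (negPf nM).
Qed.

(* Among the irreducible sets at [x] already found, the one meeting the missing
   target [M'] most can be improved: add the last element [y] of [M' \ M], and
   destroy the at most [k] premises through [y] not contained in [M'] by
   intersecting with larger, hence already found, irreducible sets. *)
Lemma saturated_pdeg : pdeg Sigma <= k -> {subset irr closed <= L}.
Proof.
move=> hk M0 hM0; apply/idPn => nM0.
pose bad M := (M \in irr closed) && (M \notin L).
have bad0 : bad M0 by rewrite /bad hM0.
(* The missing set has largest cardinality, so every larger irreducible set is in [L]. *)
case: (arg_maxnP (fun M : {set X} => #|M|) bad0) => M' /andP[hM' nM'] M'max.
have [x hx] := irrP _ hM'.
have [cM' xM' maxM'] := irr_atP _ _ hx.
have cov := irr_at_cover hx.
pose good M := (M \in L) && (M \in irr_at closed x).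
have complgood I y : I \in intersection_pool base k.+1 ->
    candidate I y x \in closed -> good (completion xs x (candidate I y x)).
  move=> hI hD; rewrite /good saturated // completion_irr_at //.
  by rewrite !inE eqxx.
(* The empty set, being closed, is itself a candidate and completes to a first irreducible set at
   [x] in [L]. *)
have good0 : good (completion xs x (candidate set0 x x)).
  apply: complgood.
    have := @mem_intersection_pool base k.+1 [:: set0 : {set X}].
    rewrite big_seq1; apply=> //; first by rewrite mem_head.
    by move=> B; rewrite inE => /eqP->; rewrite !inE eqxx orbT.
  by rewrite /candidate setU0 setDv.
case: (arg_maxnP (fun M : {set X} => #|M :&: M'|) good0) => M /andP[ML hM] Mmax.
have [cM xM maxM] := irr_atP _ _ hM.
have [M'M|] := boolP (M' \subset M).
  by move: nM'; rewrite -(maxM' M) ?ML.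
case/subsetPn => y0 y0M' y0M.
have [|y] := @exists_last (M' :\: M) y0; first by rewrite inE y0M y0M'.
rewrite inE => /andP[yM yM'] ylast.
have yx : y != x by apply: contraNneq xM' => <-.
pose S := [set r in Sigma | y \in r.1].
(* A premise inside [M'] needs no breaking, and one through [x] is already broken by [M]; there
   [setT] suffices. Otherwise [N] extends the upper cover [x |: M'], so it properly contains [M']
   and is in [L]. *)
have pickr r : exists N : {set X}, r \in S ->
    [/\ N \in base, N \in closed, M' \subset N &
        ~~ (r.1 \subset M') -> ~~ (r.1 \subset y |: (M :&: N))].
  have [_|] := boolP (r.1 \subset M').
    by exists setT; rewrite mem_head closed_setT subsetT.
  case/subsetPn => a ar aM'.
  have ay : a != y by apply: contraNneq aM' => ->.
  have [ax|ax] := eqVneq a x.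
    exists setT; rewrite mem_head closed_setT subsetT; split=> // _.
    by apply/subsetPn; exists a; rewrite // setIT !inE negb_or ay ax.
  have axM' : a \notin x |: M' by rewrite !inE negb_or ax.
  have [N hN xN] := irr_at_extend cov axM'.
  have [cN aN _] := irr_atP _ _ hN.
  have MN : M' \subset N by apply: subset_trans xN; apply: subsetUr.
  exists N => _; split=> //; last first.
    by move=> _; apply/subsetPn; exists a; rewrite // !inE !negb_or ay (negPf aN) andbF.
  suff : N \in L by rewrite !inE => ->; rewrite !orbT.
  apply/idPn => nN; have /M'max h : bad N.
    by rewrite /bad nN andbT; apply/irrP; exists a.
  suff : #|M'| < #|N| by rewrite ltnNge => /negP[]; apply: h.
  apply: proper_card.
  apply/properP; split=> //; exists x => //.
  by apply: (subsetP xN); rewrite setU11.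
have [F hF] := fin_all_exists pickr.
pose I := \bigcap_(B <- M :: [seq F r | r in S]) B.
have IE : I = M :&: \bigcap_(r in S) F r by rewrite /I big_cons big_image.
have hI : I \in intersection_pool base k.+1.
  apply: mem_intersection_pool; first by rewrite mem_head.
    move=> B; rewrite inE => /predU1P[->|].
      by rewrite !inE ML !orbT.
    by case/imageP => r rS ->; case: (hF r rS).
  (* [M] and one set for each of the at most [k] implications through [y] need [k.+1] factors. *)
  rewrite /= size_image ltnS; apply: leq_trans hk.
  exact: (leq_bigmax (F := premise_degree Sigma)).
have cI : I \in closed.
  rewrite IE closedI //.
  by apply: closed_bigcap => r rS; case: (hF r rS).
have IM : I \subset M by rewrite IE subsetIl.
have xI : x \notin I by apply: contra xM; apply: subsetP.
have DE : candidate I y x = y |: I.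
  apply/setP=> z; rewrite !inE; have [->|//] := eqVneq z x.
  by rewrite (negPf xI) eq_sym (negPf yx).
have M'I : M :&: M' \subset I.
  rewrite IE; apply: setIS; apply/bigcapsP => r rS.
  by case: (hF r rS).
(* A premise through [y] that survives lies in [M']; its conclusion lies in [M'] by closure and in
   [M] because [y] is last in [M' :\: M], hence in [I]. *)
have cD : candidate I y x \in closed.
  rewrite DE; apply/closedP => r hr rsub.
  have [yr|yr] := boolP (y \in r.1); last first.
    apply: subset_trans (subsetUr _ _); apply: (closedP _ cI) => //.
    apply/subsetP=> a ar; have /setU1P[ay|//] := subsetP rsub a ar.
    by rewrite -ay ar in yr.
  have rS : r \in S by rewrite inE hr.
  have [_ _ _ h] := hF r rS.
  have rM' : r.1 \subset M'.
    apply/idPn => /h/negP[]; apply: subset_trans rsub _.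
    by rewrite IE; apply: setUS; apply: setIS; apply: bigcap_inf.
  have r2M' := closedP _ cM' _ hr rM'.
  apply: subset_trans (subsetUr _ _); apply: subset_trans M'I.
  rewrite subsetI r2M' andbT; apply/subsetP=> b br.
  apply/idPn => bM; have /ylast : b \in M' :\: M.
    by rewrite inE bM (subsetP r2M').
  by rewrite (arcP hr yr br).
have /Mmax h := complgood I y hI cD.
(* The completion keeps [M :&: M'] and gains [y], against the choice of [M]. *)
suff : #|M :&: M'| < #|completion xs x (candidate I y x) :&: M'|.
  by rewrite ltnNge => /negP[]; apply: h.
apply: proper_card.
have sub : y |: I \subset completion xs x (candidate I y x).
  by rewrite -{1}DE sub_completion.
apply/properP; split.
  rewrite subsetI subsetIr andbT; apply: subset_trans sub.
  by apply: subset_trans M'I _; apply: subsetUr.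
exists y; last by rewrite inE (negPf yM).
by rewrite inE yM' andbT (subsetP sub) // setU11.
Qed.

End Saturation.
End AcyclicBases.

(** * Silent runs of WHILE programs *)

Fixpoint writes (c : cmd) : seq nat :=
  match c with
  | Skip | Output _ => [::]
  | Assign x _ => [:: x]
  | Seq c1 c2 | If _ c1 c2 => writes c1 ++ writes c2
  | While _ c1 => writes c1
  end.

Lemma exec_frame c s s' t tr y :
  exec c s s' t tr -> y \notin writes c -> s' y = s y.
Proof.
elim=> {c s s' t tr} //=.
- by move=> x e s; rewrite inE /update => /negPf ->.
- move=> c1 c2 s1 s2 s3 t1 t2 tr1 tr2 _ IH1 _ IH2.
  by rewrite mem_cat negb_or => /andP[h1 h2]; rewrite IH2 // IH1.
- move=> e c1 c2 s s' t tr _ IH; rewrite mem_cat negb_or => /andP[h1 h2].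
  by apply: IH; case: ifP.
- move=> e c s1 s2 s3 t1 t2 tr1 tr2 _ _ IH1 _ IH2 h.
  by rewrite IH2 // IH1.
Qed.

Definition runs (c : cmd) (s : store) (B : nat) (Q : store -> Prop) : Prop :=
  exists s' t, [/\ exec c s s' t [::], t <= B & Q s'].

Lemma runs_le B' c s B Q : runs c s B' Q -> B' <= B -> runs c s B Q.
Proof. by case=> s' [t [h1 h2 h3]] h; exists s', t; split=> //; apply: leq_trans h. Qed.

Lemma runs_Skip s Q : Q s -> runs Skip s 1 Q.
Proof. by move=> h; exists s, 1; split=> //; apply: exec_Skip. Qed.

Lemma runs_Assign x e s Q :
  Q (update s x (eval s e)) -> runs (Assign x e) s (expr_cost e).+1 Q.
Proof. by move=> h; eexists _, _; split; [apply: exec_Assign| |]. Qed.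

(** The second command also inherits all registers outside [writes c1], so postconditions can be
    confined to the result register. *)
Lemma runs_Seq c1 c2 s B1 B2 Q1 Q :
  runs c1 s B1 Q1 ->
  (forall s1, (forall y, y \notin writes c1 -> s1 y = s y) -> Q1 s1 ->
     runs c2 s1 B2 Q) ->
  runs (Seq c1 c2) s (B1 + B2) Q.
Proof.
case=> s1 [t1 [h1 h2 h3]] /(_ s1) [||s2 [t2 [h4 h5 h6]]] //.
  by move=> y; apply: exec_frame h1.
exists s2, (t1 + t2); split=> //; last exact: leq_add.
exact: (exec_Seq h1 h4).
Qed.

Lemma runs_Assign_Seq x e c s B Q :
  runs c (update s x (eval s e)) B Q ->
  runs (Seq (Assign x e) c) s ((expr_cost e).+1 + B) Q.
Proof.
case=> s' [t [h1 h2 h3]]; exists s', ((expr_cost e).+1 + t); split=> //.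
  exact: (exec_Seq (exec_Assign x e s) h1).
by rewrite leq_add2l.
Qed.

Lemma runs_If (b : bool) e c1 c2 s B Q :
  eval s e = encode_bool b ->
  runs (if b then c1 else c2) s B Q ->
  runs (If e c1 c2) s ((expr_cost e).+1 + B) Q.
Proof.
move=> he [s' [t [h1 h2 h3]]]; exists s', ((expr_cost e).+1 + t); split=> //.
  by apply: (exec_If (tr := [::])); rewrite he; case: (b) h1.
by rewrite leq_add2l.
Qed.

(** The traversal consumes register [l]; a list needed later has to be copied first. *)
Definition For (i l : nat) (c : cmd) : cmd :=
  While (Var l) (Seq (Assign i (Hd (Var l))) (Seq (Assign l (Tl (Var l))) c)).

(** The invariant [R] also sees the elements still to come. In each iteration 8 pays for the test
    and the two assignments; the final 2 is the failing test. *)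
Lemma runs_For_rem (T A : Type) (enc : T -> tree) (F : A -> T -> A)
    (R : seq T -> A -> store -> Prop) i l c s ts a B q :
  i != l -> l \notin writes c -> size ts <= q ->
  (forall rem a s1 v w, R rem a s1 -> R rem a (update (update s1 i v) l w)) ->
  s l = encode_list [seq enc t | t <- ts] -> R ts a s ->
  (forall t rem a s1,
     (forall y, y \notin [:: i, l & writes c] -> s1 y = s y) ->
     s1 i = enc t -> R (t :: rem) a s1 ->
     runs c s1 B (fun s2 => R rem (F a t) s2)) ->
  runs (For i l c) s (q * (B + 8) + 2) (fun s' => R [::] (foldl F a ts) s').
Proof.
move=> il lc szq Rupd sl Ra body.
suff main : forall s1, (forall y, y \notin [:: i, l & writes c] -> s1 y = s y) ->
    s1 l = encode_list [seq enc t | t <- ts] -> R ts a s1 ->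
    runs (For i l c) s1 (size ts * (B + 8) + 2)
      (fun s' => R [::] (foldl F a ts) s').
  apply: runs_le (main _ _ sl Ra) _ => //.
  by rewrite leq_add2r leq_mul2r szq orbT.
elim: ts a {szq sl Ra} => [|t ts IH] a s1 fr s1l Ra /=.
  exists s1, 2; split=> //; apply: (exec_While_stop (e := Var l)).
  by rewrite /= s1l.
pose s2 := update (update s1 i (enc t)) l (encode_list [seq enc t | t <- ts]).
have s2i : s2 i = enc t by rewrite /s2 /update (negPf il) eqxx.
have s2fr y : y \notin [:: i, l & writes c] -> s2 y = s1 y.
  by rewrite !inE !negb_or /s2 /update => /and3P[/negPf-> /negPf->].
have [|s3 [t3 [e3 b3 R3]]] := body t ts a s2 _ s2i (Rupd _ _ _ _ _ Ra).
  by move=> y hy; rewrite s2fr // fr.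
have [||s4 [t4 [e4 b4 R4]]] := IH (F a t) s3 _ _ R3.
- move=> y hy; rewrite (exec_frame e3) ?s2fr ?fr //.
  by move: hy; rewrite !inE !negb_or => /and3P[].
- by rewrite (exec_frame e3) // /s2 /update eqxx.
have es2 : update (update s1 i (eval s1 (Hd (Var l)))) l
    (eval (update s1 i (eval s1 (Hd (Var l)))) (Tl (Var l))) = s2.
  have upd v : update s1 i v l = s1 l by rewrite /update eq_sym (negPf il).
  by rewrite /= upd s1l.
exists s4, (2 + (3 + (3 + t3) + t4)); split=> //; last by lia.
apply: (exec_While_step (e := Var l) (tr1 := [::]) (tr2 := [::])) e4.
  by rewrite /= s1l.
apply: (exec_Seq (tr1 := [::]) (tr2 := [::]) (exec_Assign _ _ _)).
apply: (exec_Seq (tr1 := [::]) (tr2 := [::]) (exec_Assign _ _ _)).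
by rewrite es2.
Qed.

Lemma runs_For (T A : Type) (enc : T -> tree) (encA : A -> tree)
    (F : A -> T -> A) r i l c s ts a B q :
  [&& i != l, l \notin writes c, r != i & r != l] -> size ts <= q ->
  s l = encode_list [seq enc t | t <- ts] -> s r = encA a ->
  (forall t a s1,
     (forall y, y \notin [:: i, l & writes c] -> s1 y = s y) ->
     s1 i = enc t -> s1 r = encA a ->
     runs c s1 B (fun s2 => s2 r = encA (F a t))) ->
  runs (For i l c) s (q * (B + 8) + 2) (fun s' => s' r = encA (foldl F a ts)).
Proof.
case/and4P=> il lc ri rl szq sl sr body.
apply: (@runs_For_rem _ _ enc F (fun _ a s => s r = encA a)) => //.
  by move=> _ a0 s1 v w <-; rewrite /update (negPf ri) (negPf rl).
by move=> t _ a0 s1; apply: body.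
Qed.

(** * Subroutines on characteristic vectors *)

Definition lit (b : bool) : expr := if b then Cons Nil Nil else Nil.

Lemma eval_lit s b : eval s (lit b) = encode_bool b.
Proof. by case: b. Qed.

(** [f] is evaluated when the program is built, so the code contains all four cases. *)
Definition branch (e1 e2 : expr) (f : bool -> bool -> cmd) : cmd :=
  If e1 (If e2 (f true true) (f true false))
        (If e2 (f false true) (f false false)).

Definition zip_for (f : bool -> bool -> cmd) : cmd :=
  For 17 12 (Seq (branch (Var 17) (Hd (Var 13)) f) (Assign 13 (Tl (Var 13)))).

Lemma runs_branch (b1 b2 : bool) e1 e2 f s B Q :
  eval s e1 = encode_bool b1 -> eval s e2 = encode_bool b2 ->
  runs (f b1 b2) s B Q ->
  runs (branch e1 e2 f) s ((expr_cost e1).+1 + ((expr_cost e2).+1 + B)) Q.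
Proof.
move=> h1 h2 h; apply: (runs_If h1).
by case: b1 h1 h => h1 h; apply: (runs_If h2); case: b2 h2 h.
Qed.

Lemma runs_zip_for (X A : Type) (encA : A -> tree) (g : bool -> bool -> A -> A)
    r f s (ys : seq X) (P1 P2 : pred X) B a q :
  r \notin [:: 12; 13; 17] -> (forall b1 b2, all (pred1 r) (writes (f b1 b2))) ->
  size ys <= q ->
  s 12 = encode_list [seq encode_bool (P1 y) | y <- ys] ->
  s 13 = encode_list [seq encode_bool (P2 y) | y <- ys] ->
  s r = encA a ->
  (forall b1 b2 a s1, s1 r = encA a ->
     runs (f b1 b2) s1 B (fun s2 => s2 r = encA (g b1 b2 a))) ->
  runs (zip_for f) s (q * (B + 16) + 2)
    (fun s' => s' r = encA (foldl (fun a y => g (P1 y) (P2 y) a) a ys)).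
Proof.
rewrite !inE !negb_or => /and3P[r12 r13 r17] wf szq s12 s13 sr body.
have wfr y : y != r -> forall b1 b2, y \notin writes (f b1 b2).
  move=> yr b1 b2; apply: contra yr => h.
  exact: (allP (wf b1 b2)).
(* The second vector is consumed in step with the first, so register 13 holds its remaining bits. *)
pose R rem a s1 :=
  s1 13 = encode_list [seq encode_bool (P2 y) | y <- rem] /\ s1 r = encA a.
have h : runs (zip_for f) s (q * (B + 8 + 8) + 2)
    (fun s' => R [::] (foldl (fun a y => g (P1 y) (P2 y) a) a ys) s').
  apply: (@runs_For_rem _ _ (fun y => encode_bool (P1 y))) => //.
  - by rewrite /= !mem_cat !negb_or !wfr // eq_sym.
  - move=> rem a0 s1 v w [h1 h2]; rewrite /R /update /=.
    by rewrite (negPf r12) (negPf r17).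
  move=> y rem a0 s1 _ s1i [h1 h2].
  apply: runs_le (_ : 2 + (3 + B) + 3 <= _); last by lia.
  apply: (@runs_Seq _ _ _ (2 + (3 + B)) 3
           (fun s2 => s2 r = encA (g (P1 y) (P2 y) a0) /\ s2 13 = s1 13)).
    apply: (@runs_branch (P1 y) (P2 y)); rewrite ?s1i //=; first by rewrite h1.
    have [s2 [t [e2 b2 q2]]] := body (P1 y) (P2 y) a0 s1 h2.
    exists s2, t; split=> //; split=> //.
    by rewrite (exec_frame e2) // wfr // eq_sym.
  move=> s2 _ [h3 h4]; apply: runs_Assign; split.
    by rewrite /update /= h4 h1.
  by rewrite /update (negPf r13).
have [s' [t [h1 h2 []]]] := runs_le h (leqnn _).
by exists s', t; split=> //; apply: leq_trans h2 _; rewrite -addnA.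
Qed.

Definition set_op (X : finType) (op : bool -> bool -> bool) (A B : {set X}) :=
  [set x | op (x \in A) (x \in B)].

Definition SUBSET : cmd :=
  Seq (Assign 16 (lit true))
      (zip_for (fun b1 b2 => if b1 && ~~ b2 then Assign 16 Nil else Skip)).

(** The first loop collects the bits in reverse order; the second turns them back. *)
Definition ZIP (op : bool -> bool -> bool) : cmd :=
  Seq (Assign 10 Nil) (
  Seq (zip_for (fun b1 b2 => Assign 10 (Cons (lit (op b1 b2)) (Var 10)))) (
  Seq (Assign 11 Nil)
      (For 17 10 (Assign 11 (Cons (Var 17) (Var 11)))))).

Definition linear_bound (q : nat) : nat := q * 50 + 50.

Lemma foldl_cons_rev (T U : Type) (f : T -> U) acc ts :
  foldl (fun a t => f t :: a) acc ts = rev [seq f t | t <- ts] ++ acc.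
Proof.
elim: ts acc => //= t ts IH acc; rewrite IH rev_cons -cats1 -catA //.
Qed.

Section Vectors.
Variables (X : finType) (xs : seq X) (q : nat).
Hypothesis xsq : size xs <= q.
Local Notation enc := (encode_set xs).

Lemma runs_ZIP op s (A B : {set X}) : s 12 = enc A -> s 13 = enc B ->
  runs (ZIP op) s (linear_bound q) (fun s' => s' 11 = enc (set_op op A B)).
Proof.
move=> sA sB.
pose r := [seq encode_bool (op (y \in A) (y \in B)) | y <- xs].
apply: runs_le (_ : 2 + (q * (6 + 16) + 2 + (2 + (q * (4 + 8) + 2))) <= _);
  last by rewrite /linear_bound; lia.
apply: runs_Assign_Seq.
apply: (@runs_Seq _ _ _ _ _ (fun s1 => s1 10 = encode_list (rev r))).
  pose g b1 b2 a := encode_bool (op b1 b2) :: a.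
  have -> : rev r = foldl (fun a y => g (y \in A) (y \in B) a) [::] xs.
    by rewrite foldl_cons_rev cats0.
  apply: (@runs_zip_for _ _ encode_list g) => //.
  move=> b1 b2 a s1 s1r; apply: runs_le (runs_Assign _) _.
    by rewrite /update /= eval_lit s1r.
  by rewrite /=; case: (op b1 b2).
move=> s1 _ s1r; apply: runs_Assign_Seq.
have -> : enc (set_op op A B) = encode_list (foldl (fun a t => t :: a) [::] (rev r)).
  rewrite (foldl_cons_rev id) map_id revK cats0.
  by congr encode_list; apply: eq_map => y; rewrite inE.
apply: (@runs_For _ _ id) => //; first by rewrite size_rev size_map.
  by rewrite map_id /update.
move=> t a s2 _ h1 h2; apply: runs_le (runs_Assign _) _; last by [].
by rewrite /update /= h1 h2.
Qed.

Lemma runs_SUBSET s (A B : {set X}) : xs =i X -> s 12 = enc A -> s 13 = enc B ->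
  runs SUBSET s (linear_bound q) (fun s' => s' 16 = encode_bool (A \subset B)).
Proof.
move=> xsX sA sB.
apply: runs_le (_ : 4 + (q * (2 + 16) + 2) <= _);
  last by rewrite /linear_bound; lia.
apply: runs_Assign_Seq.
pose g b1 b2 a := a && ~~ (b1 && ~~ b2).
have -> : (A \subset B) = foldl (fun a y => g (y \in A) (y \in B) a) true xs.
  have H : forall a ys, foldl (fun a y => g (y \in A) (y \in B) a) a ys =
      a && all (fun y => ~~ ((y \in A) && ~~ (y \in B))) ys.
    by move=> a ys; elim: ys a => [|y ys IH] a /=; rewrite ?andbT // IH -andbA.
  rewrite H /=; apply/subsetP/allP => [h y _|h y yA].
    by rewrite negb_and negbK orbC; case yA: (y \in A); rewrite ?orbT ?h.
  by have := h y; rewrite xsX yA /= negbK; apply.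
apply: (@runs_zip_for _ _ encode_bool g) => //.
  by move=> [] [].
move=> b1 b2 a s1 h; rewrite /g; case: ifP => hb.
  by apply: runs_Assign; rewrite /update /= andbF.
apply: runs_le (runs_Skip _) _; last by [].
by rewrite andbT.
Qed.

End Vectors.

(** * One round of the saturation *)

(* Global registers: 1 the full set, 2 the implications, 3 the singletons, 4 the
   empty set, 5 the solutions found so far, 6 the outcome of a round. *)

Definition CLOSED : cmd :=
  Seq (Assign 21 (lit true)) (
  Seq (Assign 23 (Var 2))
      (For 22 23 (
         Seq (Assign 12 (Hd (Var 22))) (
         Seq (Assign 13 (Var 20)) (
         Seq SUBSET
             (If (Var 16)
                (Seq (Assign 12 (Tl (Var 22))) (
                 Seq (Assign 13 (Var 20)) (
                 Seq SUBSET
                     (If (Var 16) Skip (Assign 21 Nil)))))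
                Skip)))))).

(** Register 30 holds the growing set and 31 the singleton to avoid, so that membership of [x]
    becomes an inclusion of vectors. *)
Definition COMPLETE : cmd :=
  Seq (Assign 33 (Var 3))
      (For 32 33 (
         Seq (Assign 35 (Var 3))
             (For 34 35 (
                Seq (Assign 12 (Var 34)) (
                Seq (Assign 13 (Var 30)) (
                Seq (ZIP orb) (
                Seq (Assign 20 (Var 11)) (
                Seq (Assign 12 (Var 31)) (
                Seq (Assign 13 (Var 20)) (
                Seq SUBSET
                    (If (Var 16) Skip
                       (Seq CLOSED
                            (If (Var 21) (Assign 30 (Var 20)) Skip))))))))))))).

(** Equality is tested as mutual inclusion, since the language only tests whether a tree is a
    leaf. *)
Definition MEMBER : cmd :=
  Seq (Assign 36 Nil) (
  Seq (Assign 38 (Var 5))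
      (For 37 38 (
         Seq (Assign 12 (Var 37)) (
         Seq (Assign 13 (Var 30)) (
         Seq SUBSET
             (If (Var 16)
                (Seq (Assign 12 (Var 30)) (
                 Seq (Assign 13 (Var 37)) (
                 Seq SUBSET
                     (If (Var 16) (Assign 36 (lit true)) Skip))))
                Skip)))))).

Definition POOL_STEP : cmd :=
  Seq (Assign 41 Nil) (
  Seq (Assign 43 (Var 40)) (
  Seq (For 42 43 (
         Seq (Assign 45 (Var 46))
             (For 44 45 (
                Seq (Assign 12 (Var 42)) (
                Seq (Assign 13 (Var 44)) (
                Seq (ZIP andb)
                    (Assign 41 (Cons (Var 11) (Var 41)))))))))
      (Assign 40 (Var 41)))).

(** Unrolling at program level is possible because [k] is fixed. *)
Fixpoint repeat (k : nat) (c : cmd) : cmd :=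
  if k is k'.+1 then Seq (repeat k' c) c else Skip.

Definition POOL (k : nat) : cmd :=
  Seq (Assign 46 (Cons (Var 1) (Cons (Var 4) (Var 5)))) (
  Seq (Assign 40 (Cons (Var 1) Nil))
      (repeat k POOL_STEP)).

Definition TRY : cmd :=
  Seq (Assign 12 (Var 52)) (
  Seq (Assign 13 (Var 50)) (
  Seq (ZIP orb) (
  Seq (Assign 12 (Var 11)) (
  Seq (Assign 13 (Var 54)) (
  Seq (ZIP (fun b1 b2 => b1 && ~~ b2)) (
  Seq (Assign 20 (Var 11)) (
  Seq CLOSED
      (If (Var 21)
         (Seq (Assign 30 (Var 20)) (
          Seq (Assign 31 (Var 54)) (
          Seq COMPLETE (
          Seq MEMBER
              (If (Var 36) Skip (Assign 6 (Cons (Var 30) Nil)))))))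
         Skip)))))))).

Definition SEARCH : cmd :=
  Seq (Assign 6 Nil) (
  Seq (Assign 51 (Var 40))
      (For 50 51 (
         Seq (Assign 53 (Var 3))
             (For 52 53 (
                Seq (Assign 55 (Var 3))
                    (For 54 55 TRY)))))).

Definition ROUND (k : nat) : cmd := Seq (POOL k.+1) SEARCH.

(** * Running times in terms of a bound [q] on the input lists and the base *)

Definition closed_bound (q : nat) := q * (2 * linear_bound q + 50) + 20.
Definition complete_bound (q : nat) :=
  q * (q * (2 * linear_bound q + closed_bound q + 50) + 50) + 50.
Definition member_bound (q : nat) := q * (2 * linear_bound q + 50) + 20.
Definition pool_step_bound (k q : nat) :=
  q ^ k * (q * (linear_bound q + 50) + 50) + 50.
Definition pool_bound (k q : nat) := k * pool_step_bound k q + 50.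
Definition try_bound (q : nat) :=
  2 * linear_bound q + closed_bound q + complete_bound q + member_bound q + 100.
Definition search_bound (k q : nat) :=
  q ^ k * (q * (q * (try_bound q + 20) + 20) + 20) + 20.
Definition round_bound (k q : nat) := pool_bound k.+1 q + search_bound k.+1 q.

Ltac step := apply: runs_Assign_Seq.
Ltac skip := apply: runs_le (runs_Skip _) _; last by lia.
Ltac upd := rewrite /update /=.

Lemma notin_writes_repeat k c y :
  y \notin writes c -> y \notin writes (repeat k c).
Proof. by move=> h; elim: k => //= k IH; rewrite mem_cat negb_or IH. Qed.

Lemma notin_writes_POOL j y : y \in [:: 1; 2; 3; 4; 5] -> y \notin writes (POOL j).
Proof.
move=> hy; have h : y \notin writes (repeat j POOL_STEP).
  by apply: notin_writes_repeat; move: hy; rewrite !inE => /orP[|/or4P[]] /eqP->.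
move: hy; rewrite -[writes (POOL j)]/([:: 46, 40 & writes (repeat j POOL_STEP)]) !inE !negb_or h.
by move=> /orP[|/or4P[]] /eqP->.
Qed.

Lemma foldl_None (T U : Type) (f : option U -> T -> option U) o ts :
  (forall o t, f o t = None -> o = None) -> foldl f o ts = None -> o = None.
Proof. by move=> hf; elim: ts o => //= t ts IH o /IH/hf. Qed.

(** A found value is never erased, so a final [None] means that the accumulator was [None]
    throughout and every step failed. *)
Lemma foldl_None_step (T : eqType) (U : Type) (f : option U -> T -> option U) o ts :
  (forall o t, f o t = None -> o = None) -> foldl f o ts = None ->
  {in ts, forall t, f None t = None}.
Proof.
move=> hf; elim: ts o => //= t ts IH o h u; rewrite inE => /predU1P[->|]; last first.
  exact: IH h _.
by have h1 := foldl_None hf h; rewrite -[in RHS]h1 (hf _ _ h1).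
Qed.

Lemma foldl_Some (T : Type) (U : Type) (G : U -> Prop)
    (f : option U -> T -> option U) o ts :
  (forall o t, (forall u, o = Some u -> G u) -> forall u, f o t = Some u -> G u) ->
  (forall u, o = Some u -> G u) -> forall u, foldl f o ts = Some u -> G u.
Proof. by move=> hf; elim: ts o => //= t ts IH o ho; apply: IH; apply: hf. Qed.

(** * Correctness of one round *)

Section Round.
Variables (X : finType) (Sigma : {set {set X} * {set X}}).
Variables (xs ss : seq X) (rs : seq ({set X} * {set X})) (q : nat).
Hypothesis xsX : xs =i X.
Hypothesis ssX : ss =i X.
Hypothesis rsS : rs =i Sigma.
Hypothesis xsq : size xs <= q.
Hypothesis ssq : size ss <= q.
Hypothesis rsq : size rs <= q.
Local Notation enc := (encode_set xs).
Local Notation closed := (closed_sets Sigma).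
Local Notation singles := (encode_list [seq enc [set x] | x <- ss]).
Local Notation rules := (encode_list [seq encode_implication xs r | r <- rs]).

Definition check_rule (D : {set X}) (b : bool) (r : {set X} * {set X}) : bool :=
  if r.1 \subset D then (if r.2 \subset D then b else false) else b.

Lemma foldl_check_rule D : foldl (check_rule D) true rs = (D \in closed).
Proof.
have H b ts : foldl (check_rule D) b ts =
    b && all (fun r : {set X} * {set X} => (r.1 \subset D) ==> (r.2 \subset D)) ts.
  elim: ts b => [|r ts IH] b /=; first by rewrite andbT.
  by rewrite IH /check_rule; do 2!case: (_ \subset _); rewrite ?andbF.
rewrite H /=; apply/allP/closedP => h r hr.
  by apply/implyP; apply: h; rewrite rsS.
by apply/implyP; apply: h; rewrite -rsS.
Qed.

Lemma runs_CLOSED s D : s 2 = rules -> s 20 = enc D ->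
  runs CLOSED s (closed_bound q) (fun s' => s' 21 = encode_bool (D \in closed)).
Proof.
move=> s2 s20; apply: runs_le (_ : 4 + (2 + (q * (2 * linear_bound q + 20 + 8) + 2)) <= _);
  last by rewrite /closed_bound; lia.
step; step; rewrite -foldl_check_rule.
apply: (@runs_For _ _ (encode_implication xs)) => // r b s1 fr s1i s1r.
have f20 : s1 20 = enc D by rewrite fr.
apply: runs_le
  (_ : 3 + (2 + (linear_bound q + (2 + (3 + (2 + (linear_bound q + (2 + 2))))))) <= _);
  last by lia.
step; step.
apply: (@runs_Seq _ _ _ _ _ _ _ (@runs_SUBSET _ xs q xsq _ r.1 D xsX _ _));
  [by upd; rewrite s1i | by upd |].
move=> s3 fr3 s3f; apply: (@runs_If (r.1 \subset D)) => //; rewrite /check_rule.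
case: ifP => _; last first.
  by skip; rewrite fr3 //; upd.
step; step.
apply: (@runs_Seq _ _ _ _ _ _ _ (@runs_SUBSET _ xs q xsq _ r.2 D xsX _ _));
  [by upd; rewrite fr3 //; upd; rewrite s1i | by upd; rewrite fr3 |].
move=> s4 fr4 s4f; apply: (@runs_If (r.2 \subset D)) => //.
case: ifP => _; last by apply: runs_Assign.
by skip; rewrite fr4 //; upd; rewrite fr3.
Qed.

Lemma set_op_or A B : set_op orb A B = A :|: B :> {set X}.
Proof. by apply/setP=> x; rewrite !inE. Qed.

Lemma set_op_and A B : set_op andb A B = A :&: B :> {set X}.
Proof. by apply/setP=> x; rewrite !inE. Qed.

Lemma set_op_diff A B : set_op (fun b1 b2 => b1 && ~~ b2) A B = A :\: B :> {set X}.
Proof. by apply/setP=> x; rewrite !inE andbC. Qed.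

Lemma runs_COMPLETE s x D : s 2 = rules -> s 3 = singles ->
  s 31 = enc [set x] -> s 30 = enc D ->
  runs COMPLETE s (complete_bound q)
    (fun s' => s' 30 = enc (completion Sigma ss x D)).
Proof.
move=> s2 s3 s31 s30.
pose b1 := 2 * linear_bound q + closed_bound q + 40.
apply: runs_le (_ : 2 + (q * (2 + (q * (b1 + 8) + 2) + 8) + 2) <= _);
  last by rewrite /complete_bound /b1; lia.
step; apply: (@runs_For _ _ (fun x => enc [set x])) => // _ D1 s1 fr1 _ s1r.
step; apply: (@runs_For _ _ (fun x => enc [set x])) => // [|z E s4 fr4 s4i s4r].
  by upd; rewrite fr1.
have f2 : s4 2 = rules by rewrite fr4 //; upd; rewrite fr1.
have f31 : s4 31 = enc [set x] by rewrite fr4 //; upd; rewrite fr1.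
apply: runs_le (_ : 2 + (2 + (linear_bound q + (2 + (2 + (2 + (linear_bound q +
    (2 + (closed_bound q + (2 + 2))))))))) <= _); last by rewrite /b1; lia.
step; step.
apply: (@runs_Seq _ _ _ _ _ _ _ (@runs_ZIP _ xs q xsq orb _ [set z] E _ _)) => //.
move=> s5 fr5; rewrite set_op_or => s5o; step; step; step.
apply: (@runs_Seq _ _ _ _ _ _ _
  (@runs_SUBSET _ xs q xsq _ [set x] (z |: E) xsX _ _)) => //.
  by upd; rewrite fr5.
move=> s6 fr6; rewrite sub1set => s6f.
have s6r : s6 30 = enc E by rewrite fr6 //; upd; rewrite fr5.
apply: (runs_If (e := Var 16) s6f); rewrite /grow.
case xE: (x \in z |: E) => /=; first by skip.
apply: (@runs_Seq _ _ _ _ _ _ _ (@runs_CLOSED _ (z |: E) _ _)).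
- by rewrite fr6 //; upd; rewrite fr5.
- by rewrite fr6.
move=> s7 fr7 s7f; apply: (runs_If (e := Var 21) s7f); case: ifP => _.
  by apply: runs_Assign; upd; rewrite fr7 // fr6.
by skip; rewrite fr7.
Qed.

Lemma runs_MEMBER s (L : seq {set X}) D : size L <= q ->
  s 5 = encode_list [seq enc C | C <- L] -> s 30 = enc D ->
  runs MEMBER s (member_bound q) (fun s' => s' 36 = encode_bool (D \in L)).
Proof.
move=> Lq s5 s30.
apply: runs_le (_ : 2 + (2 + (q * (2 * linear_bound q + 20 + 8) + 2)) <= _);
  last by rewrite /member_bound; lia.
step; step.
have -> : (D \in L) = foldl (fun b C => b || (D == C)) false L.
  have H b ts : foldl (fun b C => b || (D == C)) b ts = b || (D \in ts).
    elim: ts b => [|C ts IH] b /=; first by rewrite orbF.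
    by rewrite IH inE orbA.
  by rewrite H.
apply: (@runs_For _ _ enc) => // C b s1 fr1 s1i s1r.
have f30 : s1 30 = enc D by rewrite fr1.
apply: runs_le
  (_ : 2 + (2 + (linear_bound q + (2 + (2 + (2 + (linear_bound q + (2 + 4))))))) <= _);
  last by lia.
step; step.
apply: (@runs_Seq _ _ _ _ _ _ _ (@runs_SUBSET _ xs q xsq _ C D xsX _ _)) => //.
move=> s3 fr3 s3f; rewrite eqEsubset andbC.
have s3r : s3 36 = encode_bool b by rewrite fr3.
apply: (runs_If (e := Var 16) s3f); case: ifP => _ /=; last first.
  by skip; rewrite orbF.
step; step.
apply: (@runs_Seq _ _ _ _ _ _ _ (@runs_SUBSET _ xs q xsq _ D C xsX _ _)).
- by upd; rewrite fr3.
- by upd; rewrite fr3.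
move=> s4 fr4 s4f; apply: (runs_If (e := Var 16) s4f); case: ifP => _.
  by apply: runs_Assign; upd; rewrite orbT.
by skip; rewrite fr4 // orbF.
Qed.

Section Pool.
Variables (base : seq {set X}) (k : nat).
Hypothesis qpos : 0 < q.
Hypothesis baseq : size base <= q.
Local Notation encs l := (encode_list [seq enc C | C <- l]).

Lemma runs_POOL_STEP s j : j < k -> s 46 = encs base ->
  s 40 = encs (intersection_pool base j) ->
  runs POOL_STEP s (pool_step_bound k q)
    (fun s' => s' 40 = encs (intersection_pool base j.+1)).
Proof.
move=> jk s46 s40.
apply: runs_le (_ : 2 + (2 + ((q ^ k * (2 + (q * (linear_bound q + 20 + 8) + 2) + 8)
  + 2) + 2)) <= _); last first.
  rewrite /pool_step_bound; set a := q ^ k; set b := linear_bound q.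
  have : a * (2 + (q * (b + 20 + 8) + 2) + 8) <= a * (q * (b + 50) + 50).
    by rewrite leq_mul2l; apply/orP; right; nia.
  by lia.
step; step.
apply: (@runs_Seq _ _ _ _ _ (fun s' => s' 41 = encs (intersection_pool base j.+1))).
  apply: (@runs_For _ _ enc (fun l => encs l)) => //=.
    (* The pool has [size base ^ j] members, at most [q ^ k] as [j < k] and [q] is positive; [j = 0]
       is split off because comparing bases needs a positive exponent. *)
    rewrite size_intersection_pool.
    apply: leq_trans (leq_pexp2l qpos (ltnW jk)).
    by case: (j) => // j'; rewrite leq_exp2r.
  move=> I acc s1 fr1 s1i s1r; step.
  apply: (@runs_For _ _ enc (fun l => encs l)) => //=.
    by upd; rewrite fr1.
  move=> B acc' s2 fr2 s2i s2r.
  apply: runs_le (_ : 2 + (2 + (linear_bound q + 4)) <= _); last by lia.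
  step; step.
  apply: (@runs_Seq _ _ _ _ _ _ _ (@runs_ZIP _ xs q xsq andb _ I B _ _)) => //.
    by upd; rewrite fr2 //; upd.
  move=> s3 fr3; rewrite set_op_and => s3o.
  by apply: runs_Assign; upd; rewrite s3o fr3 //; upd; rewrite s2r.
by move=> s1 _ h; apply: runs_Assign; upd.
Qed.

Lemma runs_repeat_POOL_STEP s j : j <= k -> s 46 = encs base ->
  s 40 = encs [:: [set: X]] ->
  runs (repeat j POOL_STEP) s (j * pool_step_bound k q + 1)
    (fun s' => s' 40 = encs (intersection_pool base j)).
Proof.
move=> + s46 s40; elim: j => [|j IH] jk.
  by apply: runs_le (runs_Skip _) _.
apply: runs_le (_ : j * pool_step_bound k q + 1 + pool_step_bound k q <= _);
  last by lia.
apply: runs_Seq (IH (ltnW jk)) _ => s1 fr1 h1.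
by apply: runs_POOL_STEP => //; rewrite fr1 // notin_writes_repeat.
Qed.

End Pool.

Section Search.
Variables (L : seq {set X}) (k : nat).
Hypothesis Lq : (size L).+2 <= q.
Local Notation encs l := (encode_list [seq enc C | C <- l]).
Local Notation base := [:: setT, set0 & L].

(** A later success overwrites an earlier one: the sweep is never cut short, and any new set will
    do. *)
Definition try_candidate I y (o : option {set X}) x :=
  let D := candidate I y x in
  if D \in closed then
    (if completion Sigma ss x D \in L then o else Some (completion Sigma ss x D))
  else o.

Definition search : option {set X} :=
  foldl (fun o I => foldl (fun o y => foldl (try_candidate I y) o ss) o ss)
    None (intersection_pool base k.+1).

(** A found set sits below a node, so register 6 doubles as the test of [LOOP]. *)
Definition encode_option (o : option {set X}) : tree :=
  if o is Some C then Node (enc C) Leaf else Leaf.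

Lemma runs_TRY s I y x o : s 2 = rules -> s 3 = singles -> s 5 = encs L ->
  s 50 = enc I -> s 52 = enc [set y] -> s 54 = enc [set x] ->
  s 6 = encode_option o ->
  runs TRY s (try_bound q) (fun s' => s' 6 = encode_option (try_candidate I y o x)).
Proof.
move=> s2 s3 s5 s50 s52 s54 s6.
apply: runs_le (_ : 2 + (2 + (linear_bound q + (2 + (2 + (linear_bound q + (2 +
   (closed_bound q + (2 + (2 + (2 + (complete_bound q + (member_bound q + (2 + 4)))))))))))))
   <= _); last by rewrite /try_bound; lia.
step; step.
apply: (@runs_Seq _ _ _ _ _ _ _ (@runs_ZIP _ xs q xsq orb _ [set y] I _ _)) => //.
move=> s7 fr7; rewrite set_op_or => s7o; step; step.
apply: (@runs_Seq _ _ _ _ _ _ _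
  (@runs_ZIP _ xs q xsq (fun b1 b2 => b1 && ~~ b2) _ (y |: I) [set x] _ _)) => //.
  by upd; rewrite fr7.
move=> s8 fr8; rewrite set_op_diff -/(candidate I y x) => s8o; step.
have f8 z : z \in [:: 2; 3; 5; 6; 54] -> s8 z = s z.
  by rewrite !inE => /or4P[|||/orP[]] /eqP->; rewrite fr8 //; upd; rewrite fr7.
apply: (@runs_Seq _ _ _ _ _ _ _ (@runs_CLOSED _ (candidate I y x) _ _)) => //.
  by upd; rewrite f8.
move=> s9 fr9 s9f; rewrite /try_candidate.
apply: (runs_If (e := Var 21) s9f); case: ifP => _; last first.
  by skip; rewrite fr9 //; upd; rewrite f8.
step; step.
apply: (@runs_Seq _ _ _ _ _ _ _ (@runs_COMPLETE _ x (candidate I y x) _ _ _ _)).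
- by upd; rewrite fr9 //; upd; rewrite f8.
- by upd; rewrite fr9 //; upd; rewrite f8.
- by upd; rewrite fr9 //; upd; rewrite f8.
- by upd; rewrite fr9 //; upd.
move=> s10 fr10 s10o.
have f10 z : z \in [:: 5; 6] -> s10 z = s z.
  by rewrite !inE => /orP[] /eqP->; rewrite fr10 //; upd; rewrite fr9 //; upd; rewrite f8.
apply: (@runs_Seq _ _ _ _ _ _ _ (@runs_MEMBER _ L _ _ _ s10o)).
- by lia.
- by rewrite f10.
move=> s11 fr11 s11f; apply: (runs_If (e := Var 36) s11f); case: ifP => _.
  by skip; rewrite fr11 // f10.
by apply: runs_Assign; upd; rewrite fr11 // s10o.
Qed.

Lemma size_pool : size (intersection_pool base k.+1) <= q ^ k.+1.
Proof. by rewrite size_intersection_pool leq_exp2r. Qed.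

Lemma runs_SEARCH s : s 2 = rules -> s 3 = singles -> s 5 = encs L ->
  s 40 = encs (intersection_pool base k.+1) ->
  runs SEARCH s (search_bound k.+1 q) (fun s' => s' 6 = encode_option search).
Proof.
move=> s2 s3 s5 s40.
apply: runs_le (_ : 2 + (2 + (q ^ k.+1 * (2 + (q * (2 + (q * (try_bound q + 8) + 2)
  + 8) + 2) + 8) + 2)) <= _); last first.
  rewrite /search_bound; set a := q ^ k.+1; set b := try_bound q.
  have h1 : q * (b + 8) <= q * (b + 20) by rewrite leq_mul2l leq_add2l orbT.
  have h2 : q * (2 + (q * (b + 8) + 2) + 8) <= q * (q * (b + 20) + 20).
    by rewrite leq_mul2l; apply/orP; right; lia.
  have : a * (2 + (q * (2 + (q * (b + 8) + 2) + 8) + 2) + 8) <=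
         a * (q * (q * (b + 20) + 20) + 20).
    by rewrite leq_mul2l; apply/orP; right; lia.
  by lia.
step; step.
apply: (@runs_For _ _ enc) => //; first exact: size_pool.
move=> I o s7 fr7 s7i s7r; step.
apply: (@runs_For _ _ (fun x => enc [set x])) => //.
  by upd; rewrite fr7.
move=> y o1 s8 fr8 s8i s8r; step.
apply: (@runs_For _ _ (fun x => enc [set x])) => //.
  by upd; rewrite fr8 //; upd; rewrite fr7.
move=> x o2 s9 fr9 s9i s9r.
apply: runs_TRY => //.
- by rewrite fr9 //; upd; rewrite fr8 //; upd; rewrite fr7.
- by rewrite fr9 //; upd; rewrite fr8 //; upd; rewrite fr7.
- by rewrite fr9 //; upd; rewrite fr8 //; upd; rewrite fr7.
- by rewrite fr9 //; upd; rewrite fr8 //; upd.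
- by rewrite fr9 //; upd.
Qed.

Lemma runs_ROUND s : s 1 = enc setT -> s 2 = rules -> s 3 = singles ->
  s 4 = enc set0 -> s 5 = encs L ->
  runs (ROUND k) s (round_bound k q) (fun s' => s' 6 = encode_option search).
Proof.
move=> s1 s2 s3 s4 s5.
apply: (@runs_Seq _ _ _ _ _ (fun s' => s' 40 = encs (intersection_pool base k.+1))).
  apply: runs_le (_ : 6 + (4 + (k.+1 * pool_step_bound k.+1 q + 1)) <= _);
    last by rewrite /pool_bound; lia.
  step; step; apply: runs_repeat_POOL_STEP => //=; first exact: leq_trans Lq.
    by upd; rewrite s1 s4 s5.
  by upd; rewrite s1.
move=> s6 fr h.
have f y : y \in [:: 2; 3; 5] -> s6 y = s y.
  by rewrite !inE => /or3P[] /eqP->; rewrite fr ?notin_writes_POOL.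
by apply: runs_SEARCH => //; rewrite f.
Qed.

Lemma notin_writes_ROUND y : y \in [:: 1; 2; 3; 4; 5] -> y \notin writes (ROUND k).
Proof.
move=> hy; rewrite -[writes (ROUND k)]/(writes (POOL k.+1) ++ writes SEARCH) mem_cat negb_or.
by rewrite notin_writes_POOL //; move: hy; rewrite !inE => /orP[|/or4P[]] /eqP->.
Qed.

Hypothesis acyclicS : acyclic Sigma.
Hypothesis ssn : #|X| <= size ss.

Lemma try_candidate_None I y o x : try_candidate I y o x = None -> o = None.
Proof. by rewrite /try_candidate; case: ifP => // _; case: ifP. Qed.

Lemma search_Some C : search = Some C -> C \in irr closed /\ C \notin L.
Proof.
apply: (@foldl_Some _ _ (fun C => C \in irr closed /\ C \notin L)) => // o I ho.
apply: foldl_Some => // o1 y ho1; apply: foldl_Some => // o2 x ho2 D.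
rewrite /try_candidate; case: ifP => hD; last exact: ho2.
case: ifP => hL; first exact: ho2.
case=> <-; rewrite hL; split=> //; apply/irrP; exists x.
by apply: completion_irr_at => //; rewrite !inE eqxx.
Qed.

(** Failure propagates inwards through the three nested folds; the outcome is the hypothesis
    [saturated] of the completeness lemmas. *)
Lemma search_None : search = None -> forall I y x,
  I \in intersection_pool base k.+1 -> candidate I y x \in closed ->
  completion Sigma ss x (candidate I y x) \in L.
Proof.
move=> h I y x hI hD.
have n1 I' y' := @try_candidate_None I' y'.
have n2 I' o y' : foldl (try_candidate I' y') o ss = None -> o = None.
  exact: (foldl_None (@n1 I' y')).
have n3 o I' : foldl (fun o y => foldl (try_candidate I' y) o ss) o ss = None ->
    o = None.
  exact: (foldl_None (n2 I')).
have h1 := foldl_None_step n3 h hI.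
have yss : y \in ss by rewrite ssX.
have xss : x \in ss by rewrite ssX.
have h2 := foldl_None_step (n2 I) h1 yss.
have := foldl_None_step (n1 I y) h2 xss.
by rewrite /try_candidate hD; case: ifP.
Qed.

End Search.
End Round.

(** * Polynomial bounds *)

Definition polynomial_fun (f : nat -> nat) : Prop :=
  exists p : {poly nat}, forall n, f n = p.[n]%R.

Lemma polynomial_id : polynomial_fun id.
Proof. by exists 'X%R => n; rewrite hornerX. Qed.

Lemma polynomial_cst c : polynomial_fun (fun=> c).
Proof. by exists (c%:P)%R => n; rewrite hornerC. Qed.

Lemma polynomial_add f g : polynomial_fun f -> polynomial_fun g ->
  polynomial_fun (fun n => f n + g n).
Proof. by move=> [p hp] [r hr]; exists (p + r)%R => n; rewrite hornerD hp hr. Qed.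

Lemma polynomial_mul f g : polynomial_fun f -> polynomial_fun g ->
  polynomial_fun (fun n => f n * g n).
Proof. by move=> [p hp] [r hr]; exists (p * r)%R => n; rewrite hornerM hp hr. Qed.

Lemma polynomial_exp f k : polynomial_fun f -> polynomial_fun (fun n => f n ^ k).
Proof.
move=> hf; elim: k => [|k [p hp]]; first exact: polynomial_cst.
have [r hr] := polynomial_mul hf (ex_intro _ p hp).
by exists r => n; rewrite expnS hr.
Qed.

(** The coefficients are natural numbers, so Horner evaluation is monotone. *)
Lemma polynomial_homo f : polynomial_fun f -> {homo f : m n / m <= n}.
Proof.
move=> [p hp] m n mn; rewrite !hp /horner; elim: (polyseq p) => //= a s IH.
by apply: leq_add => //; apply: leq_mul.
Qed.

(** * The enumeration program *)

(** Register 7 holds the zero vector followed by the singletons over a suffix of the ground list. An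
    iteration prefixes a coordinate: every old vector gets a 0 there, and the zero vector also
    yields the new singleton. *)
Definition SINGLETONS : cmd :=
  Seq (Assign 7 (Cons Nil Nil)) (
  Seq (Assign 8 (Var 1)) (
  Seq (For 60 8 (
         Seq (Assign 61 (Cons (Cons (lit true) (Hd (Var 7))) Nil)) (
         Seq (Assign 62 (Tl (Var 7))) (
         Seq (For 63 62 (Assign 61 (Cons (Cons Nil (Var 63)) (Var 61))))
             (Assign 7 (Cons (Cons Nil (Hd (Var 7))) (Var 61)))))))
      (Assign 3 (Tl (Var 7))))).

(** Zipping with the constant [false] yields the vector of the empty set at the right length. *)
Definition INIT : cmd :=
  Seq (Assign 1 (Hd (Var 0))) (
  Seq (Assign 2 (Tl (Var 0))) (
  Seq (Assign 12 (Var 1)) (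
  Seq (Assign 13 (Var 1)) (
  Seq (ZIP (fun _ _ => false)) (
  Seq (Assign 4 (Var 11))
      SINGLETONS))))).

Definition LOOP (k : nat) : cmd :=
  While (Var 6)
    (Seq (Output (Hd (Var 6))) (
     Seq (Assign 5 (Cons (Hd (Var 6)) (Var 5)))
         (ROUND k))).

Definition MAIN (k : nat) : cmd := Seq INIT (Seq (ROUND k) (LOOP k)).

Definition init_bound (q : nat) := linear_bound q + q * (q * 20 + 50) + 100.
(** Beyond the round, [4 * q + 30] pays for writing out one vector and for the loop overhead. *)
Definition stage_bound (k q : nat) := round_bound k q + (4 * q + 30).
Definition total_bound (k n : nat) :=
  init_bound (n + 2) + (n + 3) * stage_bound k (n + 2).

Ltac polynomial :=
  repeat first [ exact: polynomial_cst | exact: polynomial_id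
               | apply: polynomial_add | apply: polynomial_mul
               | apply: polynomial_exp ].

Lemma polynomial_stage_bound k : polynomial_fun (stage_bound k).
Proof.
rewrite /stage_bound /round_bound /pool_bound /pool_step_bound /search_bound.
rewrite /try_bound /complete_bound /member_bound /closed_bound /linear_bound.
by polynomial.
Qed.

Lemma stage_bound_homo k : {homo stage_bound k : m n / m <= n}.
Proof. exact/polynomial_homo/polynomial_stage_bound. Qed.

Lemma polynomial_total_bound k : polynomial_fun (total_bound k).
Proof.
rewrite /total_bound /init_bound.
rewrite /stage_bound /round_bound /pool_bound /pool_step_bound /search_bound.
rewrite /try_bound /complete_bound /member_bound /closed_bound /linear_bound.
by polynomial.
Qed.

Definition singletons_step (W : seq tree) : seq tree :=
  Node Leaf (head Leaf W) ::
  foldl (fun a v => Node Leaf v :: a) [:: Node (encode_bool true) (head Leaf W)]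
        (behead W).

(* The order in which [SINGLETONS] lists the elements. *)
Fixpoint listing (T : Type) (ys : seq T) : seq T :=
  if ys is y :: ys' then rev (listing ys') ++ [:: y] else [::].

Lemma perm_listing (T : eqType) (ys : seq T) : perm_eq (listing ys) ys.
Proof.
elim: ys => //= y ys IH; rewrite cats1 perm_rcons perm_cons.
by rewrite perm_rev.
Qed.

Lemma iter_singletons_step (X : finType) (ys : seq X) : uniq ys ->
  iter (size ys) singletons_step [:: Leaf] =
  encode_set ys set0 :: [seq encode_set ys [set x] | x <- listing ys].
Proof.
elim: ys => [|y ys IH] //= /andP[yys uys].
rewrite IH // /singletons_step /= (foldl_cons_rev (Node Leaf)).
congr (_ :: _); first by rewrite /encode_set /= inE.
rewrite map_cat map_rev; congr (rev _ ++ [:: _]).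
  rewrite -map_comp; apply/eq_in_map => z.
  rewrite (perm_mem (perm_listing ys)) => zys.
  rewrite /encode_set /= inE; case: eqP => // yz; by rewrite yz zys in yys.
rewrite /encode_set /= inE eqxx; congr (Node _ (encode_list _)).
by apply/eq_in_map => z zys; rewrite !inE; case: eqP => // zy; rewrite -zy zys in yys.
Qed.

Lemma foldl_iter (T A : Type) (f : A -> A) a (ts : seq T) :
  foldl (fun a _ => f a) a ts = iter (size ts) f a.
Proof. by elim: ts a => //= t ts IH a; rewrite IH -iterSr. Qed.

Lemma tree_size_encode_set (X : finType) (ys : seq X) (A : {set X}) :
  tree_size (encode_set ys A) <= 4 * size ys + 1.
Proof.
rewrite /encode_set; elim: ys => //= y ys IH.
by case: (y \in A) => /=; lia.
Qed.

Lemma outputs_delay t tr : [seq o.2 | o <- delay t tr] = [seq o.2 | o <- tr].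
Proof. by rewrite /delay -map_comp. Qed.

(** * The full enumeration and its incremental time bound *)

Section Enumeration.
Variables (X : finType) (Sigma : {set {set X} * {set X}}).
Variables (xs : seq X) (rs : seq ({set X} * {set X})) (k : nat).
Hypothesis pxs : perm_eq xs (enum X).
Hypothesis prs : perm_eq rs (enum Sigma).
Local Notation enc := (encode_set xs).
Local Notation closed := (closed_sets Sigma).
Local Notation ss := (listing xs).
Local Notation N := (#|X| + #|Sigma|).
Local Notation encs l := (encode_list [seq enc C | C <- l]).
Local Notation singles := (encode_list [seq enc [set x] | x <- ss]).
Local Notation rules := (encode_list [seq encode_implication xs r | r <- rs]).

Let xsX : xs =i X.
Proof. by move=> x; rewrite (perm_mem pxs) mem_enum. Qed.

Let ssX : ss =i X.
Proof. by move=> x; rewrite (perm_mem (perm_listing xs)) xsX. Qed.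

Let rsS : rs =i Sigma.
Proof. by move=> r; rewrite (perm_mem prs) mem_enum. Qed.

Let xs_size : size xs = #|X|.
Proof. by rewrite (perm_size pxs) -cardE. Qed.

Let ss_size : size ss = #|X|.
Proof. by rewrite (perm_size (perm_listing xs)). Qed.

Let rs_size : size rs = #|Sigma|.
Proof. by rewrite (perm_size prs) -cardE. Qed.

Lemma runs_SINGLETONS s q : size xs <= q -> s 1 = enc setT ->
  runs SINGLETONS s (q * (q * 20 + 50) + 20) (fun s' => s' 3 = singles).
Proof.
move=> xsq s1.
apply: runs_le (_ : 4 + (2 + ((q * ((9 + (3 + ((q * (6 + 8) + 2) + 7))) + 8) + 2) + 3)) <= _);
  last by nia.
step; step.
pose W := iter (size xs) singletons_step [:: Leaf].
have WE : W = enc set0 :: [seq enc [set x] | x <- ss].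
  by rewrite /W iter_singletons_step // (perm_uniq pxs) enum_uniq.
apply: (@runs_Seq _ _ _ _ _ (fun s' => s' 7 = encode_list W)); last first.
  by move=> s2 _ h; apply: runs_Assign; upd; rewrite h WE.
(* The singletons built plus the iterations to come never exceed [q], which bounds the inner
   loop. *)
pose R (rem : seq X) (a : seq tree) (s : store) :=
  s 7 = encode_list a /\ size (behead a) + size rem <= q.
suff [s' [t [h1 h2 []]]] : runs (For 60 8 (
         Seq (Assign 61 (Cons (Cons (lit true) (Hd (Var 7))) Nil)) (
         Seq (Assign 62 (Tl (Var 7))) (
         Seq (For 63 62 (Assign 61 (Cons (Cons Nil (Var 63)) (Var 61))))
             (Assign 7 (Cons (Cons Nil (Hd (Var 7))) (Var 61)))))))
    (update (update s 7 (Node Leaf Leaf)) 8 (s 1))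
    (q * ((9 + (3 + ((q * (6 + 8) + 2) + 7))) + 8) + 2)
    (R [::] (foldl (fun a _ => singletons_step a) [:: Leaf] xs)).
  by rewrite foldl_iter => h3 _; exists s', t.
apply: (@runs_For_rem _ _ (fun x => encode_bool (x \in setT))
         (fun a _ => singletons_step a) R) => //.
move=> x rem a s2 fr2 _ [h7 hsz]; step; step.
have hdW : (if encode_list a is Node l _ then l else Leaf) = head Leaf a.
  by case: (a).
have tlW : (if encode_list a is Node _ r then r else Leaf) = encode_list (behead a).
  by case: (a).
apply: (@runs_Seq _ _ _ _ _ (fun s' => s' 61 = encode_list (behead (singletons_step a)))).
  apply: (@runs_For _ _ id) => //.
  - by move: hsz => /=; lia.
  - by upd; rewrite map_id h7 tlW.
  - by upd; rewrite h7 hdW.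
  move=> v b s3 _ h1 h2; apply: runs_le (runs_Assign _) _ => //.
  by upd; rewrite h1 h2.
move=> s4 fr4 h4; apply: runs_le (runs_Assign _) _ => //.
split.
  by upd; rewrite fr4 //; upd; rewrite h7 hdW h4.
by rewrite /= foldl_cons_rev size_cat size_rev size_map /=; move: hsz => /=; lia.
Qed.

Definition ready (L : seq {set X}) (s : store) : Prop :=
  [/\ s 1 = enc setT, s 2 = rules, s 3 = singles, s 4 = enc set0 & s 5 = encs L].

Lemma runs_INIT :
  runs INIT (initial_store (encode_base xs rs)) (init_bound (N + 2)) (ready [::]).
Proof.
set q := N + 2.
have xsq : size xs <= q by rewrite xs_size /q; lia.
apply: runs_le (_ : 3 + (3 + (2 + (2 + (linear_bound q + (2 +
   (q * (q * 20 + 50) + 20)))))) <= _); last by rewrite /init_bound; lia.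
step; step; step; step.
apply: (@runs_Seq _ _ _ _ _ _ _
  (@runs_ZIP _ xs q xsq (fun _ _ => false) _ setT setT _ _)) => // s1 fr1 h1.
step; set s2 := update _ _ _.
have s21 : s2 1 = enc setT by rewrite /s2; upd; rewrite fr1.
have [s3 [t [e3 b3 q3]]] := runs_SINGLETONS xsq s21.
exists s3, t; split=> //; split=> //.
- by rewrite (exec_frame e3).
- by rewrite (exec_frame e3) // /s2; upd; rewrite fr1.
- by rewrite (exec_frame e3) // /s2; upd; rewrite h1.
- by rewrite (exec_frame e3) // /s2; upd; rewrite fr1.
Qed.

Definition stage_time (j : nat) : nat := stage_bound k (N + 2 + j).

Lemma stage_time_homo i j : i <= j -> stage_time i <= stage_time j.
Proof. by move=> ij; apply: stage_bound_homo; rewrite leq_add2l. Qed.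

Lemma runs_ROUND_ready L s : ready L s ->
  runs (ROUND k) s (round_bound k (N + 2 + size L))
    (fun s' => ready L s' /\ s' 6 = encode_option xs (search Sigma ss L k)).
Proof.
move=> [s1 s2 s3 s4 s5]; set q := N + 2 + size L.
have [||||s' [t [h1 h2 h3]]] :=
  @runs_ROUND X Sigma xs ss rs q xsX rsS _ _ _ L k _ s s1 s2 s3 s4 s5.
- by rewrite xs_size /q; lia.
- by rewrite ss_size /q; lia.
- by rewrite rs_size /q; lia.
- by rewrite /q; lia.
exists s', t; split=> //; split=> //.
by split; rewrite (exec_frame h1) // notin_writes_ROUND.
Qed.

Hypothesis acyclicS : acyclic Sigma.
Hypothesis closed0 : set0 \in closed.
Hypothesis degS : pdeg Sigma <= k \/ cdeg Sigma <= k.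

Lemma search_complete L : search Sigma ss L k = None -> {subset irr closed <= L}.
Proof.
move=> /(search_None ssX) sat.
have ssn : #|X| <= size ss by rewrite ss_size.
by case: degS => hk;
  [apply: (saturated_pdeg acyclicS) | apply: (saturated_cdeg acyclicS)]; eauto.
Qed.

(** On entry register 6 already holds the next solution, so output [i], counted from 0, waits for
    [i] full iterations and its own writing. *)
Lemma exec_LOOP L s : ready L s -> s 6 = encode_option xs (search Sigma ss L k) ->
  uniq L -> {subset L <= irr closed} ->
  exists s' t tr sols,
    [/\ exec (LOOP k) s s' t tr, perm_eq (sols ++ L) (enum (irr closed)),
        [seq o.2 | o <- tr] = [seq enc C | C <- sols],
        forall i, i < size tr ->
          (nth (0, Leaf) tr i).1 <= i.+1 * stage_time (size L + i)
      & t <= (size tr).+1 * stage_time (size L + size tr)].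
Proof.
(* Each iteration adds a new irreducible set to [L], so the number of missing ones drops. *)
have [d] := ubnP (#|irr closed| - size L).
elim: d L s => // d IH L s hd rdy s6 uL Lirr.
case E: (search Sigma ss L k) s6 => [C|] /= s6; last first.
  exists s, 2, [::], [::]; split=> //.
  - by apply: (exec_While_stop (e := Var 6)); rewrite /= s6.
  - apply: uniq_perm => //; first exact: enum_uniq.
    move=> D; rewrite mem_enum; apply/idP/idP; first exact: Lirr.
    exact: search_complete.
  - by rewrite mul1n /stage_time /stage_bound; lia.
have ssn : #|X| <= size ss by rewrite ss_size.
have [CI CL] := search_Some ssX acyclicS ssn E.
have uL' : uniq (C :: L) by rewrite /= CL.
have L'irr : {subset C :: L <= irr closed}.
  by move=> D; rewrite inE => /predU1P[->|/Lirr].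
have szL' : size (C :: L) <= #|irr closed|.
  by rewrite -(card_uniqP uL'); apply: subset_leq_card; apply/subsetP.
pose s1 := update s 5 (eval s (Cons (Hd (Var 6)) (Var 5))).
have rdy1 : ready (C :: L) s1.
  by case: rdy => ? ? ? ? h5; split=> //; rewrite /s1; upd; rewrite s6 h5.
have [s2 [tR [e2 b2 [rdy2 h2]]]] := runs_ROUND_ready rdy1.
have [|s' [t [tr [sols [h3 h4 h5 h6 h7]]]]] := IH (C :: L) s2 _ rdy2 h2 uL' L'irr.
  by move: hd szL' => /=; lia.
pose t0 := (2 + tree_size (enc C)).+1.
have e1 := exec_Output (Hd (Var 6)) s.
have evC : eval s (Hd (Var 6)) = enc C by rewrite /= s6.
rewrite evC -[expr_cost _]/2 -/t0 in e1.
have eB := exec_Seq e1 (exec_Seq (exec_Assign 5 (Cons (Hd (Var 6)) (Var 5)) s) e2).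
have is6 : is_node (eval s (Var 6)) by rewrite /= s6.
have eL := exec_While_step (e := Var 6) is6 eB h3.
have t0b : t0 <= 4 * #|X| + 4.
  by rewrite /t0; have := tree_size_encode_set xs C; rewrite xs_size; lia.
(* [2] is the loop test, [t0] the output, [5] the extension of the list and [tR] the round, which
   already runs with [C] in the list. *)
have dly : 2 + (t0 + (5 + tR)) <= stage_time (size L).+1.
  by move: b2; rewrite /stage_time /stage_bound [size (C :: L)]/=; lia.
have t0w : 2 + t0 <= stage_time (size L).
  by rewrite /stage_time /stage_bound; lia.
eexists _, _, _, (C :: sols); split; first exact: eL.
- by move: h4; rewrite -[C :: L]cat1s perm_catCA.
- by rewrite outputs_delay map_cat outputs_delay h5.
- case=> [_|i] /=.
    by rewrite mul1n addn0.
  rewrite !size_map => hi; rewrite !(nth_map (0, Leaf)) ?size_map //=.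
  have {h6} /= h6 := h6 i hi; rewrite addSnnS in h6.
  have dly' : 2 + (t0 + (5 + tR)) <= stage_time (size L + i.+1).
    by apply: leq_trans dly (stage_time_homo _); lia.
  by lia.
rewrite /= !size_map; move: h7 => /=; rewrite addSnnS => h7.
have dly' : 2 + (t0 + (5 + tR)) <= stage_time (size L + (size tr).+1).
  by apply: leq_trans dly (stage_time_homo _); lia.
by lia.
Qed.

Lemma exec_MAIN :
  exists s t tr sols,
    [/\ exec (MAIN k) (initial_store (encode_base xs rs)) s t tr,
        perm_eq sols (enum (irr closed)),
        [seq o.2 | o <- tr] = [seq enc C | C <- sols],
        forall i, i < size tr -> (nth (0, Leaf) tr i).1 <= total_bound k (N + i.+1)
      & t <= total_bound k (N + size tr)].
Proof.
have [s1 [t1 [e1 b1 r1]]] := runs_INIT.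
have [s2 [t2 [e2 b2 [r2 h2]]]] := runs_ROUND_ready r1.
have [//|s3 [t3 [tr [sols [e3 h3 h4 h5 h6]]]]] := exec_LOOP r2 h2 isT _.
exists s3, (t1 + (t2 + t3)), (delay t1 (delay t2 tr)), sols.
(* Taken at [i] and [i.+1] for the outputs, and at [size tr] twice for halting. The first round and
   [j.+1] loop stages make [j.+2] stages, absorbed by the factor [n + 3] of [total_bound]. *)
have tb j x : j <= (N + x).+1 -> N + 2 + j <= N + x + 2 -> 
    t1 + (t2 + j.+1 * stage_time j) <= total_bound k (N + x).
  move=> jx jN; set S := stage_bound k (N + x + 2).
  have wS : stage_time j <= S by apply: stage_bound_homo; lia.
  have w0 : t2 <= S.
    apply: leq_trans b2 (leq_trans (leq_addr _ _) _).
    by apply: stage_bound_homo => /=; lia.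
  have iS : t1 <= init_bound (N + x + 2).
    by apply: leq_trans b1 _; rewrite /init_bound /linear_bound; nia.
  have : j.+1 * stage_time j + S <= (N + x + 3) * S.
    rewrite addnC; apply: leq_trans (_ : j.+2 * S <= _).
      by rewrite [j.+2 * _]mulSn leq_add2l leq_mul2l wS orbT.
    by rewrite leq_mul2r; apply/orP; right; lia.
  by rewrite /total_bound -/S; lia.
split.
- exact: (exec_Seq e1 (exec_Seq e2 e3)).
- by rewrite cats0 in h3.
- by rewrite !outputs_delay.
- move=> i; rewrite !size_map => hi.
  rewrite !(nth_map (0, Leaf)) ?size_map //=.
  by apply: leq_trans (tb i i.+1 _ _); rewrite ?leq_add2l ?h5 //; lia.
- rewrite !size_map; apply: leq_trans (tb (size tr) _ _ _); rewrite ?leq_add2l ?h6 //; lia.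
Qed.

End Enumeration.

Theorem theorem1 :
  (forall k : nat, exists c : cmd,
     enumerates_irr_incremental_poly
       (fun (X : finType) (Sigma : {set {set X} * {set X}}) =>
          acyclic Sigma /\ (pdeg Sigma <= k)%N) c) /\
  (forall k : nat, exists c : cmd,
     enumerates_irr_incremental_poly
       (fun (X : finType) (Sigma : {set {set X} * {set X}}) =>
          acyclic Sigma /\ (cdeg Sigma <= k)%N) c).
Proof.
(* The same program [MAIN k] serves both bounds, since saturation implies completeness under
   either. *)
suff main k (P : forall X : finType, {set {set X} * {set X}} -> Prop) :
    (forall X Sigma, P X Sigma -> acyclic Sigma /\ (pdeg Sigma <= k \/ cdeg Sigma <= k)) ->
    enumerates_irr_incremental_poly P (MAIN k).
  by split=> k; exists (MAIN k); apply: main => X Sigma [? ?]; split=> //; [left|right].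
move=> PS; have [p hp] := polynomial_total_bound k; exists p.
move=> X Sigma [_ closed0] /PS[acS degS] xs rs pxs prs.
have [s [t [tr [sols [h1 h2 h3 h4 h5]]]]] := exec_MAIN pxs prs acS closed0 degS.
exists s, t, tr, sols; split=> //; split=> [i hi|]; last by rewrite -hp.
by rewrite -hp; apply: h4.
Qed.
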